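(* Let $1\le p<2$, $\alpha=\frac1p-\frac12$, and let $N$ be a positive integer with \[ \log N\ \ge\ \frac{324}{\alpha}\max\Bigl(50,\ \log\frac{4}{\alpha}\Bigr)^2 . \] Put $\theta=\frac1{18}\sqrt{\alpha\log N}$. Then there exists an integer $n=n(N,p)\ge 0$ for which \[ n\le 2N e^{-\theta}, \qquad d_{n}\bigl(\mathcal E_N,L_p(\mathbb T)\bigr)\le\frac{8}{\alpha}\,e^{-\theta}. \] In particular, for each fixed $p\in[1,2)$, as $N\to\infty$, \[ n(N,p)\le 2N\exp\Bigl(-\tfrac1{18}\sqrt{\alpha\log N}\Bigr)=o(N), \qquad d_{n(N,p)}\bigl(\mathcal E_N,L_p(\mathbb T)\bigr)\to 0, \] that is, the trigonometric system is not rigid in $L_p(\mathbb T)$.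
   Context: $\log$ is the natural logarithm. For a bounded set $W$ in a normed space $X$ and an integer $n\ge0$, the Kolmogorov width of order $n$ is \[ d_n(W,X)=\inf_{L\subset X}\ \sup_{x\in W}\ \inf_{y\in L}\|x-y\|_X, \] where the infimum is over linear subspaces $L$ of $X$ of dimension at most $n$. All spaces and subspaces are complex. $\mathbb T=\mathbb R/\mathbb Z$ carries Lebesgue measure normalized by $\int_{\mathbb T}dt=1$; $L_p(\mathbb T)$ is the space of measurable complex-valued functions with finite norm $\|f\|_{L_p(\mathbb T)}=\bigl(\int_{\mathbb T}|f|^p\bigr)^{1/p}$. Write $e(t)=e^{2\pi i t}$, $e_k(t)=e(kt)$, and $\mathcal E_N=\{e_k\mid k\in\mathbb Z,\ |k|\le N\}\subset L_p(\mathbb T)$. ''Not rigid'' means here exactly that, as $N\to\infty$, there are dimensions $n(N,p)=o(N)$ with $d_{n(N,p)}(\mathcal E_N,L_p(\mathbb T))\to0$. *)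

(* Defs.v *)
From HB Require Import structures.
From mathcomp Require Import all_boot all_order all_algebra.
From mathcomp Require Import generic_quotient ring_quotient.
From mathcomp Require Import complex.
From mathcomp Require Import all_classical all_reals all_analysis.
From mathcomp Require Import measurable_realfun.

Set Implicit Arguments.
Unset Strict Implicit.
Unset Printing Implicit Defensive.

Import Order.TTheory GRing.Theory Num.Theory.
Import numFieldNormedType.Exports.
Import ComplexField.Normc.

Local Open Scope classical_set_scope.
Local Open Scope ring_scope.
Local Open Scope complex_scope.
Local Open Scope quotient_scope.

Section ComplexLpFunctions.
Context d (T : measurableType d) (R : realType).
Variables (mu : {measure set T -> \bar R}) (p : R).
Implicit Types f g : T -> R[i].

Definition measurable_cfun f :=
  measurable_fun setT (fun x => complex.Re (f x)) /\
  measurable_fun setT (fun x => complex.Im (f x)).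

Definition cLnorm f : \bar R := Lnorm mu p%:E (fun x => (normc (f x))%:E).

Lemma normcE (z : R[i]) : normc z = Num.sqrt (complex.Re z ^+ 2 + complex.Im z ^+ 2).
Proof. by case: z. Qed.

Lemma normc_ge0 (z : R[i]) : 0 <= normc z.
Proof. by rewrite normcE sqrtr_ge0. Qed.

Lemma norm_normc (z : R[i]) : `|z| = (normc z)%:C.
Proof. by []. Qed.

Lemma normcD (z w : R[i]) : normc (z + w) <= normc z + normc w.
Proof. by have := ler_normD z w; rewrite !norm_normc -rmorphD /= lecR. Qed.

Lemma ReD (z w : R[i]) : complex.Re (z + w) = complex.Re z + complex.Re w.
Proof. by case: z w => [a b] [c e]. Qed.

Lemma ImD (z w : R[i]) : complex.Im (z + w) = complex.Im z + complex.Im w.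
Proof. by case: z w => [a b] [c e]. Qed.

Lemma ReM (z w : R[i]) :
  complex.Re (z * w) = complex.Re z * complex.Re w - complex.Im z * complex.Im w.
Proof. by case: z w => [a b] [c e]. Qed.

Lemma ImM (z w : R[i]) :
  complex.Im (z * w) = complex.Re z * complex.Im w + complex.Im z * complex.Re w.
Proof. by case: z w => [a b] [c e]. Qed.

Lemma measurable_cfun0 : measurable_cfun 0.
Proof. by split; exact: measurable_cst. Qed.

Lemma measurable_cfunD f g :
  measurable_cfun f -> measurable_cfun g -> measurable_cfun (f + g).
Proof.
move=> [fr fi] [gr gi]; split.
- apply: (eq_measurable_fun (fun x => complex.Re (f x) + complex.Re (g x))).
    by move=> x _; rewrite -ReD.
  exact: measurable_funD.
- apply: (eq_measurable_fun (fun x => complex.Im (f x) + complex.Im (g x))).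
    by move=> x _; rewrite -ImD.
  exact: measurable_funD.
Qed.

Lemma measurable_cfunZ (a : R[i]) f :
  measurable_cfun f -> measurable_cfun (a *: f).
Proof.
move=> [fr fi]; split.
- apply: (eq_measurable_fun (fun x =>
    complex.Re a * complex.Re (f x) - complex.Im a * complex.Im (f x))).
    by move=> x _; rewrite -ReM.
  by apply: measurable_funB; apply: measurable_funM => //; exact: measurable_cst.
- apply: (eq_measurable_fun (fun x =>
    complex.Re a * complex.Im (f x) + complex.Im a * complex.Re (f x))).
    by move=> x _; rewrite -ImM.
  by apply: measurable_funD; apply: measurable_funM => //; exact: measurable_cst.
Qed.

Lemma measurable_normc f :
  measurable_cfun f -> measurable_fun setT (fun x => normc (f x)).
Proof.
move=> [fr fi].
under eq_fun do rewrite normcE.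
apply: (measurableT_comp (f := @Num.sqrt R)).
  by apply: continuous_measurable_fun; exact: sqrt_continuous.
by apply: measurable_funD; exact: measurable_funX.
Qed.

Lemma cLnormE f :
  cLnorm f = ((\int[mu]_x ((normc (f x)) `^ p)%:E) `^ p^-1)%E.
Proof.
rewrite /cLnorm unlock; congr (_ `^ _)%E; apply: eq_integral => x _.
by rewrite abse_EFin poweR_EFin ger0_norm// normc_ge0.
Qed.

Lemma measurable_normc_powR f : measurable_cfun f ->
  measurable_fun setT (fun x => ((normc (f x)) `^ p)%:E).
Proof.
move=> mf; apply/measurable_EFinP.
by apply: (measurableT_comp (measurable_powR _)); exact: measurable_normc.
Qed.

Hypothesis p1 : 1 <= p.

Let p0 : p != 0. Proof. by rewrite gt_eqF// (lt_le_trans _ p1). Qed.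

Lemma cLnorm_ge0 f : (0 <= cLnorm f)%E.
Proof. exact: Lnorm_ge0. Qed.

Lemma cLnorm0 : cLnorm 0 = 0%E.
Proof.
rewrite /cLnorm (_ : (fun _ => _) = cst 0%E); first by rewrite Lnorm0 ?eqe.
by apply/funext => x; rewrite normc0.
Qed.

Lemma cLnormD f g : measurable_cfun f -> measurable_cfun g ->
  (cLnorm (f + g)%R <= cLnorm f + cLnorm g)%E.
Proof.
move=> mf mg.
apply: (le_trans _ (minkowski_EFin mu (measurable_normc mf)
  (measurable_normc mg) p1)).
rewrite cLnormE unlock /=.
have pV0 : 0 <= p^-1 by rewrite invr_ge0 (le_trans _ p1).
have h x : `|normc (f x) + normc (g x)| = normc (f x) + normc (g x).
  by rewrite ger0_norm// addr_ge0// normc_ge0.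
under [in leRHS]eq_integral => x _ do rewrite h.
apply: gt0_ler_poweR; rewrite ?in_itv /= ?leey ?andbT ?integral_ge0//.
- by move=> x _; rewrite lee_fin powR_ge0.
- by move=> x _; rewrite lee_fin powR_ge0.
apply: ge0_le_integral => //.
- by move=> x _; rewrite lee_fin powR_ge0.
- exact/measurable_normc_powR/measurable_cfunD.
- apply/measurable_EFinP; apply: (measurableT_comp (measurable_powR _)).
  by apply: measurable_funD; exact: measurable_normc.
- move=> x _; rewrite lee_fin ge0_ler_powR ?nnegrE ?(le_trans _ p1)//.
  + exact: normc_ge0.
  + by rewrite addr_ge0// normc_ge0.
  + exact: normcD.
Qed.

Lemma cLnormZ (a : R[i]) f : measurable_cfun f ->
  cLnorm (a *: f) = ((normc a)%:E * cLnorm f)%E.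
Proof.
move=> mf; rewrite !cLnormE.
have na := normc_ge0 a.
have h x : ((normc ((a *: f) x)) `^ p)%:E
    = ((normc a `^ p)%:E * ((normc (f x)) `^ p)%:E)%E.
  rewrite -EFinM -powRM ?normc_ge0//; congr (_ `^ _)%:E; exact: normcM.
under eq_integral => x _ do rewrite h.
rewrite ge0_integralZl//; last 3 first.
- exact: measurable_normc_powR.
- by move=> x _; rewrite lee_fin powR_ge0.
- by rewrite lee_fin powR_ge0.
rewrite poweRM ?integral_ge0 ?lee_fin ?powR_ge0//; last first.
  by move=> x _; rewrite lee_fin powR_ge0.
by rewrite poweR_EFin -powRrM mulfV// powRr1.
Qed.

Lemma cLnorm_eq0 f : measurable_cfun f ->
  cLnorm f = 0%E <-> {ae mu, forall x, f x = 0}.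
Proof.
move=> mf; split => [f0|f0].
- have : (fun x => (normc (f x))%:E) = \0%E %[ae mu].
    apply: Lnorm_eq0_eq0 f0.
      exact/measurable_EFinP/measurable_normc.
    by rewrite lte_fin (lt_le_trans _ p1).
  apply: filterS => x /(_ I) [].
  exact: eq0_normc.
- rewrite -cLnorm0 !cLnormE; congr (_ `^ _)%E.
  apply: ae_eq_integral => //.
  + exact: measurable_normc_powR.
  + exact/measurable_normc_powR/measurable_cfun0.
  + by apply: filterS f0 => x -> _.
Qed.

End ComplexLpFunctions.

(* [Lp_cplx mu p1] is the space of measurable complex functions with finite
   p-norm modulo equality mu-a.e. The proof [p1] of [1 <= p] is a parameter so
   that the linear and normed structures can be inferred from the type. *)
Section LpSpace.
Context d (T : measurableType d) (R : realType).
Variables (mu : {measure set T -> \bar R}) (p : R) (p1 : 1 <= p).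

Definition Lfun_cplx_pred of 1 <= p : {pred T -> R[i]} :=
  mem [set f | measurable_cfun f /\ (cLnorm mu p f < +oo)%E].

Lemma Lfun_cplx_submod_closed : GRing.submod_closed (Lfun_cplx_pred p1).
Proof.
split=> [|a f g]; rewrite !inE.
  by split; [exact: measurable_cfun0|rewrite cLnorm0].
move=> [mf lf] [mg lg]; split.
  by apply: measurable_cfunD => //; exact: measurable_cfunZ.
apply: (le_lt_trans (cLnormD _ p1 (measurable_cfunZ a mf) mg)).
rewrite lte_add_pinfty// cLnormZ// lte_mul_pinfty ?lee_fin//.
exact: normc_ge0.
Qed.

HB.instance Definition _ :=
  GRing.isSubmodClosed.Build R[i] (T -> R[i]) (Lfun_cplx_pred p1)
    Lfun_cplx_submod_closed.

Record Lfun_cplx : Type := MkLfun {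
  Lfun_val :> T -> R[i];
  _ : Lfun_val \in Lfun_cplx_pred p1 }.

HB.instance Definition _ := [isSub for Lfun_val].
HB.instance Definition _ := [Choice of Lfun_cplx by <:].
HB.instance Definition _ := [SubChoice_isSubLmodule of Lfun_cplx by <:].

Lemma Lfun_cplxP (f : Lfun_cplx) :
  measurable_cfun f /\ (cLnorm mu p f < +oo)%E.
Proof. by case: f => f /=; rewrite inE. Qed.

Definition Lfun_null : {pred Lfun_cplx} :=
  mem [set f : Lfun_cplx | {ae mu, forall x, f x = 0}].

Lemma Lfun_null_submod_closed : GRing.submod_closed Lfun_null.
Proof.
split=> [|a f g]; rewrite !inE /=; first by apply: filterS (aeW mu _) => // x; exact.
move=> f0 g0; apply: filterS2 f0 g0 => x fx gx.
transitivity (a * f x + g x) => //.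
by rewrite fx gx mulr0 addr0.
Qed.

HB.instance Definition _ :=
  GRing.isSubmodClosed.Build R[i] Lfun_cplx Lfun_null Lfun_null_submod_closed.

Definition Lp_cplx : Type := {ideal_quot Lfun_null}.
HB.instance Definition _ := GRing.Zmodule.on Lp_cplx.
HB.instance Definition _ := EqQuotient.on Lp_cplx.

Definition Lp_class (f : Lfun_cplx) : Lp_cplx := \pi f.
Definition Lp_repr (x : Lp_cplx) : Lfun_cplx := repr x.

Lemma Lp_reprK x : Lp_class (Lp_repr x) = x.
Proof. exact: reprK. Qed.

Lemma Lp_classD f g : Lp_class (f + g) = Lp_class f + Lp_class g.
Proof. exact: raddfD. Qed.

Lemma Lp_class_eq (f g : Lfun_cplx) :
  Lp_class f = Lp_class g <-> {ae mu, forall x, f x = g x}.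
Proof.
have -> : (Lp_class f = Lp_class g) <-> (f - g \in Lfun_null).
  by rewrite Quotient.idealrBE; split=> /eqP.
rewrite inE; split; apply: filterS => x.
  move=> fg; have /eqP : f x - g x = 0 by exact: fg.
  by rewrite subr_eq0 => /eqP.
by move=> fg; transitivity (f x - g x) => //; rewrite fg subrr.
Qed.

Definition Lp_scale (a : R[i]) (x : Lp_cplx) : Lp_cplx :=
  Lp_class (a *: Lp_repr x).

Lemma Lp_classZ a f : Lp_scale a (Lp_class f) = Lp_class (a *: f).
Proof.
apply/Lp_class_eq.
have /Lp_class_eq := Lp_reprK (Lp_class f).
apply: filterS => x h.
suff : a * Lp_repr (Lp_class f) x = a * f x by exact.
by rewrite h.
Qed.

Fact Lp_scaleA a b x : Lp_scale a (Lp_scale b x) = Lp_scale (a * b) x.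
Proof. by rewrite -[x]Lp_reprK !Lp_classZ scalerA. Qed.

Fact Lp_scale1 : left_id 1 Lp_scale.
Proof. by move=> x; rewrite -[x]Lp_reprK Lp_classZ scale1r. Qed.

Fact Lp_scaleDr : right_distributive Lp_scale +%R.
Proof.
move=> a x y; rewrite -[x]Lp_reprK -[y]Lp_reprK -Lp_classD !Lp_classZ.
by rewrite scalerDr Lp_classD.
Qed.

Fact Lp_scaleDl x : {morph Lp_scale^~ x : a b / a + b}.
Proof. by move=> a b; rewrite -[x]Lp_reprK !Lp_classZ scalerDl Lp_classD. Qed.

HB.instance Definition _ := GRing.Zmodule_isLmodule.Build R[i] Lp_cplx
  Lp_scaleA Lp_scale1 Lp_scaleDr Lp_scaleDl.

Definition Lp_norm (x : Lp_cplx) : R[i] := (fine (cLnorm mu p (Lp_repr x)))%:C.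

Lemma cLnorm_ae (f g : Lfun_cplx) :
  {ae mu, forall x, f x = g x} -> cLnorm mu p f = cLnorm mu p g.
Proof.
move=> fg; rewrite !cLnormE; congr (_ `^ _)%E.
have [mf _] := Lfun_cplxP f; have [mg _] := Lfun_cplxP g.
apply: ae_eq_integral => //.
- exact: measurable_normc_powR.
- exact: measurable_normc_powR.
- by apply: filterS fg => x -> _.
Qed.

Lemma Lp_norm_class f : Lp_norm (Lp_class f) = (fine (cLnorm mu p f))%:C.
Proof.
congr (fine _)%:C; apply: cLnorm_ae; apply/Lp_class_eq; exact: Lp_reprK.
Qed.

Lemma cLnorm_fin_num (f : Lfun_cplx) : cLnorm mu p f \is a fin_num.
Proof. by rewrite ge0_fin_numE ?cLnorm_ge0//; case: (Lfun_cplxP f). Qed.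

Fact Lp_ler_normD x y : Lp_norm (x + y) <= Lp_norm x + Lp_norm y.
Proof.
rewrite -[x]Lp_reprK -[y]Lp_reprK -Lp_classD !Lp_norm_class -rmorphD lecR.
have [mf _] := Lfun_cplxP (Lp_repr x); have [mg _] := Lfun_cplxP (Lp_repr y).
rewrite -lee_fin EFinD !fineK ?cLnorm_fin_num//; exact: cLnormD.
Qed.

Fact Lp_normrZ a x : Lp_norm (a *: x) = `|a| * Lp_norm x.
Proof.
rewrite -[x]Lp_reprK [_ *: _]Lp_classZ !Lp_norm_class norm_normc -rmorphM /=.
have [mf _] := Lfun_cplxP (Lp_repr x).
by rewrite [cLnorm _ _ _](cLnormZ _ p1 a mf) fineM// cLnorm_fin_num.
Qed.

Fact Lp_normr0_eq0 x : Lp_norm x = 0 -> x = 0.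
Proof.
have [mf _] := Lfun_cplxP (Lp_repr x).
move=> /complexI x0; rewrite -[x]Lp_reprK.
rewrite -[RHS](raddf0 \pi_Lp_cplx); apply/Lp_class_eq.
apply/(cLnorm_eq0 _ p1 mf).
by rewrite -[LHS]fineK ?cLnorm_fin_num// x0.
Qed.

HB.instance Definition _ := Lmodule_isNormed.Build R[i] Lp_cplx
  Lp_ler_normD Lp_normrZ Lp_normr0_eq0.

Lemma Lp_normE (f : Lfun_cplx) :
  `|Lp_class f| = (fine (cLnorm mu p f))%:C.
Proof. exact: Lp_norm_class. Qed.

End LpSpace.

Section KolmogorovWidth.
Context (R : realType) (V : normedModType R[i]).

Definition linear_subspace (L : set V) :=
  L 0 /\ forall (a : R[i]) u v, L u -> L v -> L (a *: u + v).

Definition dim_le (n : nat) (L : set V) :=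
  exists m (b : 'I_m -> V), [/\ (m <= n)%N,
    forall c : 'I_m -> R[i], \sum_i c i *: b i = 0 -> forall i, c i = 0 &
    L = [set \sum_i c i *: b i | c in [set: 'I_m -> R[i]]]].

(* Norms over the field [R[i]] take (real nonnegative) values in [R[i]]. The
   infima and suprema are taken in the extended reals, so that the supremum is
   +oo when the distances to L are unbounded on W, and -oo when W is empty. *)
Definition kolmogorov_width (n : nat) (W : set V) : \bar R :=
  ereal_inf [set
    ereal_sup [set
      ereal_inf [set (complex.Re `|x - y|)%:E | y in L] | x in W]
    | L in [set L | linear_subspace L /\ dim_le n L]].

Definition not_rigid (W : nat -> set V) :=
  exists n : nat -> nat,
    (fun N => (n N)%:R : R^o) =o_\oo (fun N => N%:R : R^o) /\
    kolmogorov_width (n N) (W N) @[N --> \oo] --> 0%E.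

End KolmogorovWidth.

Section TrigonometricSystem.
Context (R : realType).

(* Functions on [R/Z] are represented by their restriction to the fundamental
   domain [0, 1[; its complement is null for this measure, so the values taken
   there are irrelevant in [Lp_cplx]. *)
Definition circle_measure : {measure set (measurableTypeR R) -> \bar R} :=
  mrestr (@lebesgue_measure R) (measurable_itv `[0, 1[).

(* e_k(t) = exp(2 pi i k t) *)
Definition trig (k : int) : measurableTypeR R -> R[i] :=
  fun t => cos (2 * pi * (k%:~R * t)) +i* sin (2 * pi * (k%:~R * t)).

Lemma measurable_trig k : measurable_cfun (trig k).
Proof.
split=> /=; apply: continuous_measurable_fun => t.
- apply: (@continuous_comp _ _ _ (fun t : R => 2 * pi * (k%:~R * t)) cos).
    by apply: cvgM; [exact: cvg_cst|apply: cvgM; [exact: cvg_cst|exact: cvg_id]].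
  exact: continuous_cos.
- apply: (@continuous_comp _ _ _ (fun t : R => 2 * pi * (k%:~R * t)) sin).
    by apply: cvgM; [exact: cvg_cst|apply: cvgM; [exact: cvg_cst|exact: cvg_id]].
  exact: continuous_sin.
Qed.

Lemma circle_measureT : circle_measure setT = 1%E.
Proof.
rewrite /circle_measure /= /mrestr setTI lebesgue_measure_itv /= lte01.
by rewrite oppr0 adde0.
Qed.

Lemma cLnorm_trig (p : R) k : cLnorm circle_measure p (trig k) = 1%E.
Proof.
rewrite cLnormE; under eq_integral do
  rewrite /= cos2Dsin2 sqrtr1 powR1.
by rewrite integral_cst// mul1e circle_measureT poweR_EFin powR1.
Qed.

Section Lp.
Variables (p : R) (p1 : 1 <= p).

Fact trig_Lfun k : trig k \in Lfun_cplx_pred circle_measure p1.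
Proof. by rewrite inE; split; [exact: measurable_trig|rewrite cLnorm_trig ltry]. Qed.

Definition trig_Lp (k : int) : Lp_cplx circle_measure p1 :=
  Lp_class (MkLfun (trig_Lfun k)).

Definition trig_system (N : nat) : set (Lp_cplx circle_measure p1) :=
  [set trig_Lp k | k in [set k : int | `|k| <= N%:Z]].

End Lp.
End TrigonometricSystem.
Arguments trig_system {R p} p1 N.

(* Main.v *)
Require Import Defs.
From mathcomp Require Import all_boot all_order all_algebra.
From mathcomp Require Import complex.
From mathcomp Require Import all_classical all_reals all_analysis.
From mathcomp Require Import measurable_realfun.
From mathcomp Require Import ring lra.

(** The argument exhibits a low-dimensional space by adding to each exponential
    a spike: a function of L_2 norm at most a constant, concentrated on so small
    a set that its L_p norm is tiny when p < 2.

    One digit. Take r exponentials e_0, ..., e_(r-1) and r further ones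
    e_r, ..., e_(2r-1). The unitary involution swapping the two blocks through
    the discrete Fourier transform of order r sends each e_k to a multiple of a
    translated Dirichlet kernel of length r, which is a spike ([spike]). Since U
    is a self-adjoint involution exchanging two blocks of size r, 1 + U has rank
    r: the 2r functions e_k + U e_k ([spiked]) span a space of dimension only r,
    half the number of exponentials ([spiked_span]).

    Many digits. With q = 2r and k = k_0 + k_1 q + ... + k_(m-1) q^(m-1), the
    exponential e_k(x) is the product of the e_(k_i)(q^i x). Replacing every
    factor by its spiked version ([digit_product]) yields functions in a space
    of dimension r^m, which is 2^(-m) times the number q^m of exponentials
    ([digit_product_spanned]).

    The error. It telescopes over the digits ([digit_product_error]), each term
    being, up to a unimodular factor, one spike in the variable q^i x times the
    spiked factors of the higher digits. The L_2 norm of such a product is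
    controlled because base-q expansions are unique, so that squared L_2 norms
    multiply ([energy_mul_comp], [parseval]). Its L_1 norm is small because of
    the spike. Let K be the average of M consecutive powers that equals 1 at the
    peak; split f = f (1 - K) + f K. The factor 1 - K vanishes at the peak, which
    cancels the spike, while K has L_2 norm M^(-1/2) ([averaging_poly]), which
    bounds f K by the Cauchy-Schwarz inequality. Interpolating between L_1 and
    L_2 turns this into smallness in L_p, with exponent 2 (1/p - 1/2)
    ([spiky_pth_power], [spiky_product_Lp]).

    Finally r = j^8 and m are chosen from N: m is about 3 theta, so that the
    factor 2^(-m) beats exp (- theta), and j is the least integer for which q^m
    exceeds 2 N; then log j is at least 10 theta / alpha, which makes the error
    far smaller than required ([parameter_choice]). Multiplying by e_(-N) moves
    the frequencies 0, ..., 2 N to -N, ..., N. *)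

Set Implicit Arguments.
Unset Strict Implicit.
Unset Printing Implicit Defensive.

Import Order.TTheory GRing.Theory Num.Theory.
Import numFieldNormedType.Exports.
Import ComplexField.Normc.

Local Open Scope classical_set_scope.
Local Open Scope ring_scope.

(** * Complex moduli *)

Section ModulusFacts.
Variable R : realType.
Implicit Types z w : R[i].

Lemma normcX z n : normc (z ^+ n) = normc z ^+ n.
Proof. by elim: n => [|n IH]; rewrite ?expr0 ?normc1// !exprS normcM IH. Qed.

Lemma normc_sum (I : Type) (s : seq I) (P : pred I) (F : I -> R[i]) :
  normc (\sum_(i <- s | P i) F i) <= \sum_(i <- s | P i) normc (F i).
Proof.
elim/big_rec2: _ => [|i y x _ h]; first by rewrite normc0.
by apply: (le_trans (normcD _ _)); rewrite lerD2l.
Qed.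

Lemma normc_opp z : normc (- z) = normc z.
Proof. by case: z => a b; rewrite /= !sqrrN. Qed.

Lemma normcR (x : R) : normc x%:C%C = `|x|.
Proof. by rewrite /= expr0n/= addr0 sqrtr_sqr. Qed.

End ModulusFacts.

(** * Coefficient energy of polynomials *)

Section Energy.
Variable R : realType.
Local Notation C := R[i].
Implicit Types p g A B : {poly C}.

(** By [parseval], the squared L_2 norm on the circle of x |-> p(e(x)). *)
Definition energy p : R := \sum_(i < size p) normc p`_i ^+ 2.

Lemma energy_ge0 p : 0 <= energy p.
Proof. by apply: sumr_ge0 => i _; rewrite sqr_ge0. Qed.

Lemma energyE n p : (size p <= n)%N -> energy p = \sum_(i < n) normc p`_i ^+ 2.
Proof.
move=> pn; rewrite /energy.
rewrite (big_ord_widen n (fun i => normc p`_i ^+ 2) pn) big_mkcond /=.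
apply: eq_bigr => i _; case: ltnP => // /(nth_default 0) ->.
by rewrite normc0 expr0n.
Qed.

Lemma energy1 : energy 1 = 1.
Proof. by rewrite /energy size_poly1 big_ord1 coef1 eqxx normc1 expr1n. Qed.

Lemma energyC c : energy c%:P = normc c ^+ 2.
Proof. by rewrite (@energyE 1) ?size_polyC_leq1// big_ord1 coefC eqxx. Qed.

Lemma energyXn n : energy 'X^n = 1.
Proof.
rewrite (@energyE n.+1) ?size_polyXn// big_ord_recr/= big1 => [|i _].
  by rewrite coefXn eqxx normc1 expr1n add0r.
by rewrite coefXn ltn_eqF// normc0 expr0n.
Qed.

Lemma energyD A B : energy (A + B) <= 2 * (energy A + energy B).
Proof.
pose n := maxn (size A) (size B).
rewrite (@energyE n) ?(leq_trans (size_polyD _ _))//.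
rewrite (@energyE n A) ?leq_maxl// (@energyE n B) ?leq_maxr//.
rewrite -big_split mulr_sumr /=; apply: ler_sum => i _; rewrite coefD.
have h := normcD A`_i B`_i.
apply: (@le_trans _ _ ((normc A`_i + normc B`_i) ^+ 2)).
  by rewrite lerXn2r ?nnegrE ?addr_ge0 ?normc_ge0.
(* (|a| + |b|)^2 + (|a| - |b|)^2 = 2 (|a|^2 + |b|^2) *)
by have := sqr_ge0 (normc A`_i - normc B`_i); nra.
Qed.

Lemma energy_shift q A B : (size A <= q)%N ->
  energy (A + B * 'X^q) = energy A + energy B.
Proof.
move=> Aq; rewrite (@energyE (q + size B)); last first.
  rewrite (leq_trans (size_polyD _ _))// geq_max (leq_trans Aq) ?leq_addr//=.
  by rewrite (leq_trans (size_polyMleq _ _))// size_polyXn addnS/= addnC.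
rewrite big_split_ord/= (energyE Aq); congr (_ + _); apply: eq_bigr => i _.
  by rewrite coefD coefMXn ltn_ord addr0.
rewrite coefD coefMXn ltnNge leq_addr/= addKn nth_default ?add0r//.
by rewrite (leq_trans Aq)// leq_addr.
Qed.

(** Uniqueness of base-q expansions: if A has size at most q, the monomials of
    A * g(X^q) coming from different pairs of monomials of A and g are distinct,
    and the moduli of their coefficients multiply. *)
Lemma energy_mul_comp q A g : (0 < q)%N -> (size A <= q)%N ->
  energy (A * (g \Po 'X^q)) = energy A * energy g.
Proof.
move=> q0 Aq; elim/poly_ind: g => [|g c IH].
  by rewrite comp_poly0 mulr0 /energy size_poly0 !big_ord0 mulr0.
rewrite comp_polyD comp_polyM comp_polyX comp_polyC mulrDr addrC mulrA.
(* g = g' X + c turns the product into c A, of size at most q, plus a multiple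
   of X^q. *)
rewrite energy_shift; last first.
  by rewrite mulrC mul_polyC (leq_trans (size_scale_leq _ _)).
rewrite IH [g * 'X + _]addrC -['X]expr1 energy_shift ?size_polyC_leq1//.
rewrite energyC mulrDr; congr (_ + _).
rewrite [A * _]mulrC mul_polyC (energyE (leq_trans (size_scale_leq _ _) Aq)).
rewrite (energyE Aq) mulr_suml; apply: eq_bigr => i _.
by rewrite coefZ normcM exprMn mulrC.
Qed.

Lemma energy_comp q g : (0 < q)%N -> energy (g \Po 'X^q) = energy g.
Proof.
move=> q0; rewrite -[_ \Po _]mul1r energy_mul_comp ?size_poly1//.
by rewrite energy1 mul1r.
Qed.

Lemma energy_sum n a (c : nat -> C) :
  energy (\sum_(l < n) c l *: 'X^(a + l)) = \sum_(l < n) normc (c l) ^+ 2.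
Proof.
have -> : \sum_(l < n) c l *: 'X^(a + l) = 0 + (\poly_(l < n) c l) * 'X^a.
  rewrite add0r poly_def mulr_suml; apply: eq_bigr => i _.
  by rewrite -scalerAl -exprD addnC.
rewrite energy_shift ?size_poly0// {1}/energy size_poly0 big_ord0 add0r.
rewrite (energyE (size_poly _ _)); apply: eq_bigr => i _.
by rewrite coef_poly ltn_ord.
Qed.

End Energy.

(** * Halving the dimension by adding spikes *)

Section SpikyGadget.
Variable R : realType.
Local Notation C := R[i].

(** Modelled on s (1 + y + ... + y^(r-1)) at y = om w, a translated Dirichlet
    kernel: its modulus is at most 2 s / |1 - y| on the unit circle. *)
Definition spiky (s : R) (S : {poly C}) :=
  exists2 om : C, normc om = 1 &
    forall w, normc w = 1 -> normc S.[w] * normc (1 - om * w) <= 2 * s.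

Lemma geometric_bound (y : C) n : normc y = 1 ->
  normc (\sum_(l < n) y ^+ l) * normc (1 - y) <= 2.
Proof.
move=> y1; rewrite -normcM mulrC -opprB mulNr -subrX1 normc_opp.
apply: (le_trans (normcD _ _)).
by rewrite normcX y1 expr1n normc_opp normc1.
Qed.

Variables (r : nat) (zeta : C) (s : R).
Hypotheses (r0 : (0 < r)%N) (zeta_prim : r.-primitive_root zeta)
  (zeta1 : normc zeta = 1) (s0 : 0 <= s) (sr : s ^+ 2 * r%:R = 1).

(** The image of the k-th monomial under the Hermitian involution of span
    (1, X, ..., X^(2r-1)) that exchanges the first and last r monomials through
    the unitary r x r Fourier matrix; s = r^(-1/2) is its normalization. *)
Definition spike (k : nat) : {poly C} :=
  if (k < r)%N then \sum_(l < r) (s%:C%C * zeta ^+ (k * l)) *: 'X^(r + l)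
  else \sum_(i < r) (s%:C%C * zeta^-1 ^+ ((k - r) * i)) *: 'X^(0 + i).

Lemma energy_spike k : energy (spike k) = 1.
Proof.
have s2 : normc s%:C%C ^+ 2 = s ^+ 2 by rewrite normcR real_normK ?num_real.
rewrite /spike; case: ifP => _.
  rewrite (energy_sum r r (fun l => s%:C%C * zeta ^+ (k * l))).
  under eq_bigr do rewrite normcM normcX zeta1 expr1n mulr1 s2.
  by rewrite sumr_const card_ord -mulr_natr.
rewrite (energy_sum r 0 (fun l => s%:C%C * zeta^-1 ^+ ((k - r) * l))).
under eq_bigr do rewrite normcM normcX normcV zeta1 invr1 expr1n mulr1 s2.
by rewrite sumr_const card_ord -mulr_natr.
Qed.

Lemma size_spike k : (size (spike k) <= r + r)%N.
Proof.
rewrite /spike; case: ifP => _; apply: (leq_trans (size_sum _ _ _));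
  apply/bigmax_leqP => i _; apply: (leq_trans (size_scale_leq _ _));
  by rewrite size_polyXn ?ltn_add2l// ltn_addr.
Qed.

Lemma spiky_spike k : spiky s (spike k).
Proof.
have key om a : normc om = 1 -> forall w, normc w = 1 ->
    normc (\sum_(l < r) (s%:C%C * om ^+ l) *: 'X^(a + l)).[w]
      * normc (1 - om * w) <= 2 * s.
  move=> om1 w w1.
  have -> : (\sum_(l < r) (s%:C%C * om ^+ l) *: 'X^(a + l)).[w] =
      s%:C%C * w ^+ a * \sum_(l < r) (om * w) ^+ l.
    rewrite horner_sum mulr_sumr; apply: eq_bigr => l _.
    by rewrite hornerZ hornerXn exprMn exprD; ring.
  rewrite !normcM normcX w1 expr1n mulr1 normcR ger0_norm// -mulrA mulrC.
  rewrite ler_wpM2r// geometric_bound// normcM om1 w1 mulr1 //.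
rewrite /spike; case: ifP => _.
- exists (zeta ^+ k); first by rewrite normcX zeta1 expr1n.
  by under eq_bigr do rewrite exprM; apply: key; rewrite normcX zeta1 expr1n.
- exists (zeta^-1 ^+ (k - r)); first by rewrite normcX normcV zeta1 invr1 expr1n.
  under eq_bigr do rewrite exprM; apply: key.
  by rewrite normcX normcV zeta1 invr1 expr1n.
Qed.

Lemma root_orthogonality (l l' : nat) : (l < r)%N -> (l' < r)%N ->
  \sum_(i < r) zeta^-1 ^+ (l * i) * zeta ^+ (i * l') = (if l == l' then r%:R else 0).
Proof.
move=> lr l'r; have z0 : zeta != 0.
  by apply: contra_eq_neq zeta1 => ->; rewrite normc0 eq_sym oner_neq0.
pose y := zeta^-1 ^+ l * zeta ^+ l'.
have yE : y = zeta ^+ l' / zeta ^+ l by rewrite /y exprVn mulrC.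
have -> : \sum_(i < r) zeta^-1 ^+ (l * i) * zeta ^+ (i * l') = \sum_(i < r) y ^+ i.
  by apply: eq_bigr => i _; rewrite exprMn -!exprM [(l' * i)%N]mulnC.
case: eqP => [ll'|/eqP ll'].
  have -> : y = 1 by rewrite yE ll' divff// expf_neq0.
  under eq_bigr do rewrite expr1n.
  by rewrite sumr_const card_ord.
have y1 : y - 1 != 0.
  rewrite subr_eq0; apply: contra ll' => /eqP y1.
  have : zeta ^+ l' == zeta ^+ l.
    by rewrite -[_ ^+ l]mul1r -y1 yE divfK// expf_neq0.
  by rewrite (eq_prim_root_expr zeta_prim) !modn_small// eq_sym.
apply: (mulfI y1); rewrite -subrX1 mulr0 yE expr_div_n -!exprM.
by rewrite ![(_ * r)%N]mulnC !exprM (prim_expr_order zeta_prim) !expr1n divr1 subrr.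
Qed.

Definition spiked (k : nat) : {poly C} := 'X^k + spike k.

Lemma energy_spiked k : energy (spiked k) <= 4.
Proof.
by apply: (le_trans (energyD _ _)); rewrite energyXn energy_spike; lra.
Qed.

Lemma size_spiked k : (k < r + r)%N -> (size (spiked k) <= r + r)%N.
Proof.
move=> kr; rewrite (leq_trans (size_polyD _ _))// geq_max size_spike size_polyXn.
by rewrite kr.
Qed.

(** The involution U squares to 1, hence U (1 + U) = 1 + U: applied to the k-th
    monomial of the last block, this writes its spiked version through those of
    the first block. In coordinates it is the orthogonality of the rows of the
    Fourier matrix. *)
Lemma spiked_span k : (k < r + r)%N ->
  exists c : 'I_r -> C, spiked k = \sum_i c i *: spiked i.
Proof.
case: (ltnP k r) => [kr _|rk krr].
  exists (fun i => (i == Ordinal kr)%:R).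
  rewrite (bigD1 (Ordinal kr))//= eqxx scale1r.
  by rewrite big1 ?addr0// => i /negbTE ->; rewrite scale0r.
have lr : (k - r < r)%N by rewrite ltn_subLR.
exists (fun i => s%:C%C * zeta^-1 ^+ ((k - r) * i)).
rewrite /spiked [RHS](eq_bigr _ (fun i _ => scalerDr _ _ _)) big_split /= [LHS]addrC.
congr (_ + _).
  by rewrite {1}/spike ltnNge rk.
under eq_bigr => i _ do rewrite /spike ltn_ord scaler_sumr.
rewrite exchange_big /= (bigD1 (Ordinal lr)) //= [X in _ + X]big1 => [|l lk].
- rewrite addr0 -[LHS]scale1r subnKC//.
  under eq_bigr do rewrite scalerA.
  rewrite -scaler_suml; congr (_ *: _).
  rewrite -[1]/(1%:C%C) -sr rmorphM rmorphXn rmorph_nat /=.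
  transitivity (s%:C%C ^+ 2 *
    \sum_(i < r) zeta^-1 ^+ ((k - r) * i) * zeta ^+ (i * (k - r))).
    by rewrite root_orthogonality// eqxx.
  by rewrite mulr_sumr; apply: eq_bigr => i _; ring.
- under eq_bigr do rewrite scalerA.
  rewrite -scaler_suml; apply/eqP; rewrite scaler_eq0; apply/orP; left; apply/eqP.
  transitivity (s%:C%C ^+ 2 *
    \sum_(i < r) zeta^-1 ^+ ((k - r) * i) * zeta ^+ (i * l)).
    by rewrite mulr_sumr; apply: eq_bigr => i _; ring.
  rewrite root_orthogonality//; case: eqP => [kl|_]; last by rewrite mulr0.
  by move/eqP: lk; case; apply/val_inj.
Qed.

End SpikyGadget.

(** * Exponentials on the circle *)

Section TrigFacts.
Variable R : realType.
Local Notation C := R[i].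
Implicit Types (k l : int) (x : R).

Lemma trigD k l x : trig (k + l) x = trig k x * trig l x :> C.
Proof.
rewrite /trig; apply/eqP; rewrite eq_complex /=.
have -> : 2 * pi * ((k + l)%:~R * x) = 2 * pi * (k%:~R * x) + 2 * pi * (l%:~R * x).
  by rewrite intrD; ring.
by rewrite cosD sinD eqxx/= addrC.
Qed.

Lemma trig0 x : trig 0 x = 1 :> C.
Proof. by rewrite /trig mul0r mulr0 cos0 sin0. Qed.

Lemma trigX (n : nat) x : trig n%:Z x = trig 1 x ^+ n :> C.
Proof.
by elim: n => [|n IH]; rewrite ?trig0 ?expr0// exprS -IH -trigD intS.
Qed.

Lemma conj_trig k x : (trig k x)^*%C = trig (- k) x :> C.
Proof. by rewrite /trig /= rmorphN mulNr mulrN cosN sinN. Qed.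

Lemma trig_at1 k : trig k (1 : R) = 1 :> C.
Proof.
have h (n : nat) : trig n%:Z (1 : R) = 1 :> C.
  rewrite trigX /trig !mulr1 mulr_natl cos2pi sin2pi; exact: expr1n.
by case: k => n //; rewrite NegzE -conj_trig h rmorph1.
Qed.

Lemma normc_trig k x : normc (trig k x : C) = 1.
Proof. by rewrite /trig /= cos2Dsin2 sqrtr1. Qed.

Lemma trig_inv_prim_root (r : nat) : (0 < r)%N ->
  r.-primitive_root (trig 1 (r%:R^-1 : R) : C).
Proof.
move=> r0; have r0' : r%:R != 0 :> R by rewrite pnatr_eq0 -lt0n.
apply/andP; split=> //; apply/forallP => i.
rewrite unity_rootE -trigX.
have [->|ir] := eqVneq i.+1 r.
  rewrite /trig -pmulrn divff// mulr1 eq_complex /= mulrC mulr_natr cos2pi sin2pi.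
  by rewrite !eqxx.
apply/eqP/negbTE; have {}ir : (i.+1 < r)%N by rewrite ltn_neqAle ir ltn_ord.
rewrite /trig eq_complex negb_and; apply/orP; left => /=.
set t : R := pi * (i.+1%:R / r%:R).
have -> : 2 * pi * (i.+1%:~R * r%:R^-1) = t *+ 2 by rewrite /t -pmulrn; ring.
rewrite cos_mulr2n cos2sin2 lt_eqF//.
(* cos (2 t) = 1 - 2 (sin t)^2 with 0 < t < pi *)
suff : 0 < sin t ^+ 2 by lra.
rewrite exprn_gt0// sin_gt0_pi// /t mulr_gt0 ?pi_gt0 ?divr_gt0 ?ltr0n//=.
by rewrite gtr_pMr ?pi_gt0// ltr_pdivrMr ?ltr0n// mul1r ltr_nat.
Qed.

Lemma normc_sqrE (w : C) : normc w ^+ 2 = complex.Re (w * w^*%C).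
Proof.
case: w => a b /=; rewrite sqr_sqrtr ?addr_ge0 ?sqr_ge0//.
by rewrite mulrN opprK -!expr2.
Qed.

End TrigFacts.

(** * Orthogonality on the circle *)

Section CircleIntegral.
Variable R : realType.
Local Notation C := R[i].
Local Notation mu := (@circle_measure R).
Local Notation leb := (@lebesgue_measure R).

Lemma continuous_Re_trig (c : C) (k : int) :
  continuous (fun x : R => complex.Re (c * trig k x)).
Proof.
move=> t; rewrite (_ : (fun x => _) = (fun x : R =>
    complex.Re c * cos (2 * pi * (k%:~R * x)) -
    complex.Im c * sin (2 * pi * (k%:~R * x)))); last first.
  by apply/funext => x; rewrite Defs.ReM.
have h : {for t, continuous (fun t : R => 2 * pi * (k%:~R * t))}.
  by apply: cvgM; [exact: cvg_cst|apply: cvgM; [exact: cvg_cst|exact: cvg_id]].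
apply: cvgB; apply: cvgM; try exact: cvg_cst.
- by apply: (@continuous_comp _ _ _ (fun t : R => 2 * pi * (k%:~R * t)) cos) => //;
    exact: continuous_cos.
- by apply: (@continuous_comp _ _ _ (fun t : R => 2 * pi * (k%:~R * t)) sin) => //;
    exact: continuous_sin.
Qed.

Lemma Re_le_normc (w : C) : `|complex.Re w| <= normc w.
Proof.
case: w => a b /=; rewrite -sqrtr_sqr ler_wsqrtr// lerDl sqr_ge0 //.
Qed.

Let I01 : set (measurableTypeR R) := [set` `[0%R, 1%R[].

Lemma circle_measure_setC : mu (~` I01) = 0%E.
Proof. by rewrite /circle_measure /= /mrestr setICl measure0. Qed.

Lemma integrable_Re_trig (c : C) (k : int) :
  mu.-integrable setT (EFin \o (fun x : R => complex.Re (c * trig k x))).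
Proof.
apply: measurable_bounded_integrable => //.
- by rewrite circle_measureT ltry.
- by apply: continuous_measurable_fun; exact: continuous_Re_trig.
- exists (normc c); split; rewrite ?num_real// => M cM x _ /=.
  apply: (le_trans (Re_le_normc _)).
  by rewrite normcM normc_trig mulr1 ltW.
Qed.

(** The half-open fundamental domain and the closed interval have the same
    integrals; the latter is the form suited to antiderivatives. *)
Lemma integral_circle (f : R -> \bar R) : mu.-integrable setT f ->
  (\int[mu]_x f x = \int[leb]_(x in `[0%R, 1%R]) f x)%E.
Proof.
move=> fi; rewrite (@negligible_integral _ _ _ _ _ (~` I01))//; last 2 first.
- by apply: measurableC; exact: measurable_itv.
- exact: circle_measure_setC.
rewrite setDE setTI setCK.
rewrite -integral_itv_bndo_bndc; last first.
  by apply: (measurable_funS _ (@subsetT _ _) (measurable_int _ fi)).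
apply: eq_measure_integral => A mA AD.
by rewrite /circle_measure /= /mrestr; congr (leb _); apply/setIidPl.
Qed.

(** For k != 0 the integrand has a 1-periodic antiderivative. The constant c
    covers the real parts of all the cross terms in Parseval's identity. *)
Lemma integral_Re_trig (c : C) (k : int) :
  (\int[mu]_x (complex.Re (c * trig k x))%:E =
   (if k == 0 then complex.Re c else 0)%:E)%E.
Proof.
have [->|k0] := eqVneq k 0.
  under eq_integral do rewrite trig0 mulr1.
  by rewrite integral_cst// circle_measureT mule1.
rewrite (integral_circle (integrable_Re_trig c k)).
set w : R := 2 * pi * k%:~R.
have w0 : w != 0 
  by rewrite mulf_neq0 ?intr_eq0// mulf_neq0// gt_eqF ?pi_gt0.
pose F (x : R) : R :=
  w^-1 * (complex.Re c * sin (w * x) + complex.Im c * cos (w * x)).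
have dF (x : R) : is_derive x 1 F (complex.Re (c * trig k x)).
  rewrite /F; apply: is_derive_eq.
  rewrite Defs.ReM /= [2 * pi * (_ * x)]mulrA -/w /GRing.scale /=.
  by field.
rewrite (@continuous_FTC2 _ _ F) ?ltr01//.
- rewrite /F mulr0 mulr1 cos0 sin0 mulr0 add0r mulr1 -EFinB.
  have : trig k (1 : R) = 1 :> C by exact: trig_at1.
  rewrite /trig mulr1 -/w => -[-> ->].
  by congr EFin; ring.
- by apply: continuous_subspaceT; exact: continuous_Re_trig.
- have cF x : {for x, continuous F}.
    by apply/differentiable_continuous/derivable1_diffP.
  split=> //; first by apply: cvg_at_right_filter; exact: cF.
  by apply: cvg_at_left_filter; exact: cF.
- by move=> x _; rewrite derive1E; apply: derive_val.
Qed.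

End CircleIntegral.

(** * Trigonometric polynomials and Parseval's identity *)

Section Parseval.
Variable R : realType.
Local Notation C := R[i].
Local Notation mu := (@circle_measure R).
Implicit Type P : {poly C}.

(** The factor e(a x) makes negative frequencies available to ordinary
    polynomials in z = e(x). *)
Definition trig_poly (a : int) P : measurableTypeR R -> C :=
  fun x => trig a x * P.[trig 1 x].

Lemma trig_polyE a P :
  trig_poly a P = \sum_(i < size P) P`_i *: trig (a + i%:Z).
Proof.
apply/funext => x; rewrite fct_sumE /trig_poly horner_coef mulr_sumr.
apply: eq_bigr => i _; rewrite -trigX -[RHS]/(P`_i * trig (a + i%:Z) x) trigD.
by rewrite mulrCA.
Qed.

Lemma trig_poly_Lfun a P (p : R) (p1 : 1 <= p) :
  trig_poly a P \in Lfun_cplx_pred mu p1.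
Proof.
by rewrite trig_polyE rpred_sum// => i _; rewrite rpredZ ?trig_Lfun.
Qed.

Lemma measurable_trig_poly a P : measurable_cfun (trig_poly a P).
Proof. by have := trig_poly_Lfun a P (lexx 1); rewrite inE => -[]. Qed.

Lemma normc_trig_poly a P x : normc (trig_poly a P x) = normc P.[trig 1 x].
Proof. by rewrite normcM normc_trig mul1r. Qed.

Lemma measurable_normc_horner P :
  measurable_fun setT (fun x : measurableTypeR R => normc P.[trig 1 x]).
Proof.
rewrite (_ : (fun _ => _) = (fun x => normc (trig_poly 0 P x))).
  exact/measurable_normc/measurable_trig_poly.
by apply/funext => x; rewrite normc_trig_poly.
Qed.

Lemma parseval P :
  (\int[mu]_x (normc P.[trig 1 x] ^+ 2)%:E = (energy P)%:E)%E.
Proof.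
have key x : normc P.[trig 1 x] ^+ 2 = \sum_(i < size P) \sum_(j < size P)
    complex.Re ((P`_i * (P`_j)^*%C) * trig (i%:Z - j%:Z) x).
  have ReS n (F : 'I_n -> C) : complex.Re (\sum_i F i) = \sum_i complex.Re (F i).
    by apply: (big_morph _ (@Defs.ReD R)).
  rewrite normc_sqrE horner_coef rmorph_sum mulr_suml ReS.
  apply: eq_bigr => i _; rewrite mulr_sumr ReS; apply: eq_bigr => j _.
  rewrite rmorphM -!trigX [X in _ * (_ * X)]conj_trig trigD; congr complex.Re.
  by rewrite mulrACA.
under eq_integral => x _.
  rewrite key -sumEFin; under eq_bigr do rewrite -sumEFin.
  over.
rewrite integral_sum//; last first.
  by move=> i; apply: integrable_sum => // j _; exact: integrable_Re_trig.
rewrite /energy -sumEFin; apply: eq_bigr => i _.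
rewrite integral_sum//; last by move=> j; exact: integrable_Re_trig.
rewrite (bigD1 i)//= big1 ?adde0 => [|j ji].
  by rewrite integral_Re_trig subrr eqxx normc_sqrE.
rewrite integral_Re_trig subr_eq0 ifN//.
by apply: contra ji => /eqP[] ij; apply/eqP/val_inj; rewrite /= ij.
Qed.

End Parseval.

(** * Interpolation between first and second moments *)

Section Interpolation.
Context d (T : measurableType d) (R : realType) (mu : {measure set T -> \bar R}).

Lemma powRDpos (t r s : R) : 0 < t -> t `^ (r + s) = t `^ r * t `^ s.
Proof. by move=> t0; apply: powRD; apply/implyP => _; rewrite gt_eqF. Qed.

(** Below the threshold lam the linear term alone dominates t^p, above it the
    quadratic one does. *)
Lemma powR_le_interp (p lam t : R) : 1 <= p -> p < 2 -> 0 < lam -> 0 <= t ->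
  t `^ p <= lam `^ (p - 1) * t + lam `^ (p - 2) * t ^+ 2.
Proof.
move=> p1 p2 lam0; rewrite le_eqVlt => /predU1P[<-|t0].
  by rewrite powR0 ?expr0n ?mulr0 ?addr0// gt_eqF// (lt_le_trans _ p1).
have pE : t `^ p = t `^ (p - 1) * t.
  by rewrite -[X in _ * X](@powRr1 _ t) ?(ltW t0)// -powRDpos// subrK.
have pE2 : t `^ p = t `^ (p - 2) * t ^+ 2.
  by rewrite -powR_mulrn ?(ltW t0)// -powRDpos// subrK.
have [tl|lt] := leP t lam.
  rewrite (@le_trans _ _ (lam `^ (p - 1) * t))//.
    by rewrite pE ler_wpM2r ?(ltW t0)// ge0_ler_powR ?nnegrE ?subr_ge0// ltW.
  by rewrite lerDl mulr_ge0 ?powR_ge0 ?sqr_ge0.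
rewrite (@le_trans _ _ (lam `^ (p - 2) * t ^+ 2))//.
  rewrite pE2 ler_wpM2r ?sqr_ge0//.
  rewrite -[p - 2]opprB !powRN lef_pV2 ?posrE ?powR_gt0//.
  by rewrite ge0_ler_powR ?nnegrE ?subr_ge0// ltW.
by rewrite lerDr mulr_ge0 ?powR_ge0 ?ltW.
Qed.

(** Let b bound the L_2 norms of f and g. The pointwise inequality between f, g
    and K and the Cauchy-Schwarz inequality bound the L_1 norm of f by b * eps;
    [powR_le_interp] with threshold lam = b / eps balances the first and second
    moments. Cauchy-Schwarz is used in the form 2 x y <= x^2 + y^2 with weights,
    so that the p-th power is dominated pointwise by a combination of squares. *)
Lemma spiky_pth_power (p b delta kappa eps : R) (f g K : T -> R) :
  mu setT = 1%E ->
  1 <= p -> p < 2 -> 0 < b -> 0 <= delta -> 0 < kappa -> 0 < eps ->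
  delta + kappa <= eps ->
  measurable_fun setT f -> measurable_fun setT g -> measurable_fun setT K ->
  (forall x, 0 <= f x) ->
  (forall x, f x <= delta * g x + f x * K x) ->
  (\int[mu]_x (f x ^+ 2)%:E <= (b ^+ 2)%:E)%E ->
  (\int[mu]_x (g x ^+ 2)%:E <= (b ^+ 2)%:E)%E ->
  (\int[mu]_x (K x ^+ 2)%:E <= (kappa ^+ 2)%:E)%E ->
  (\int[mu]_x (f x `^ p)%:E <= (2 * b `^ p * eps `^ (2 - p))%:E)%E.
Proof.
move=> muT p1 p2 b0 d0 k0 e0 dke mf mg mK f0 fgK If Ig IK.
pose lam := b / eps; have lam0 : 0 < lam by rewrite divr_gt0.
pose l1 := lam `^ (p - 1); have l10 : 0 <= l1 by exact: powR_ge0.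
pose l2 := lam `^ (p - 2); have l20 : 0 <= l2 by exact: powR_ge0.
pose A := l1 * (delta / (2 * b)); pose B := l1 * (delta * b / 2).
pose D := l1 * (kappa / (2 * b)) + l2; pose E := l1 * (b / (2 * kappa)).
have A0 : 0 <= A by rewrite mulr_ge0// divr_ge0// mulr_ge0// ltW.
have B0 : 0 <= B by rewrite mulr_ge0// divr_ge0// mulr_ge0// ltW.
have D0 : 0 <= D by rewrite addr_ge0// mulr_ge0// divr_ge0 ?mulr_ge0// ltW.
have E0 : 0 <= E by rewrite mulr_ge0// divr_ge0 ?mulr_ge0// ltW.
have pw x : f x `^ p <= A * g x ^+ 2 + (B + (D * f x ^+ 2 + E * K x ^+ 2)).
  apply: (le_trans (powR_le_interp p1 p2 lam0 (f0 x))); rewrite -/l1 -/l2.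
  suff : f x <= delta / (2 * b) * g x ^+ 2 + (delta * b / 2 +
      (kappa / (2 * b) * f x ^+ 2 + b / (2 * kappa) * K x ^+ 2)).
    move=> /(ler_wpM2l l10) h; apply: (le_trans (lerD h (lexx _))).
    by rewrite /A /B /D /E le_eqVlt; apply/orP; left; apply/eqP; ring.
  apply: (le_trans (fgK x)).
  have h1 : g x <= g x ^+ 2 / (2 * b) + b / 2.
    rewrite -subr_ge0 (_ : _ - _ = (g x - b) ^+ 2 / (2 * b)); last first.
      by field; rewrite gt_eqF.
    by rewrite divr_ge0 ?sqr_ge0// mulr_ge0// ltW.
  have h2 : f x * K x <= kappa / (2 * b) * f x ^+ 2 + b / (2 * kappa) * K x ^+ 2.
    rewrite -subr_ge0.
    rewrite (_ : _ - _ = (kappa * f x - b * K x) ^+ 2 / (2 * b * kappa)); last first.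
      by field; rewrite !gt_eqF.
    by rewrite divr_ge0 ?sqr_ge0// !mulr_ge0// ltW.
  have := ler_wpM2l d0 h1; rewrite mulrDr => h3.
  apply: (le_trans (lerD h3 h2)); rewrite le_eqVlt; apply/orP; left; apply/eqP.
  by field; rewrite !gt_eqF.
have msq (h : T -> R) : measurable_fun setT h ->
    measurable_fun setT (fun x => (h x ^+ 2)%:E).
  by move=> mh; apply/measurable_EFinP; exact: measurable_funX.
have sq0 (h : T -> R) x : (0 <= (h x ^+ 2)%:E)%E by rewrite lee_fin sqr_ge0.
have Z a (h : T -> R) : 0 <= a -> measurable_fun setT h ->
    (\int[mu]_x (a%:E * (h x ^+ 2)%:E) = a%:E * \int[mu]_x (h x ^+ 2)%:E)%E.
  by move=> a0 mh; rewrite ge0_integralZl ?lee_fin//; exact: msq.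
have mZ a (h : T -> R) : measurable_fun setT h ->
    measurable_fun setT (fun x => a%:E * (h x ^+ 2)%:E)%E.
  by move=> mh; apply: measurable_funeM; exact: msq.
have Z0 a (h : T -> R) x : 0 <= a -> (0 <= a%:E * (h x ^+ 2)%:E)%E.
  by move=> a0; rewrite mule_ge0 ?lee_fin ?sqr_ge0.
apply: (@le_trans _ _ (\int[mu]_x (A%:E * (g x ^+ 2)%:E +
    (B%:E + (D%:E * (f x ^+ 2)%:E + E%:E * (K x ^+ 2)%:E))))%E).
  apply: ge0_le_integral => //.
  - by move=> x _; rewrite lee_fin powR_ge0.
  - by apply/measurable_EFinP; apply: (measurableT_comp (measurable_powR _)).
  - by apply: emeasurable_funD; [exact: mZ|apply: emeasurable_funD => //;
      apply: emeasurable_funD; exact: mZ].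
  - by move=> x _; rewrite -!EFinM -!EFinD lee_fin.
rewrite ge0_integralD//; last 4 first.
- by move=> x _; exact: Z0.
- exact: mZ.
- by move=> x _; apply: adde_ge0 => //; apply: adde_ge0; exact: Z0.
- by apply: emeasurable_funD => //; apply: emeasurable_funD; exact: mZ.
rewrite ge0_integralD//; last 2 first.
- by move=> x _; apply: adde_ge0; exact: Z0.
- by apply: emeasurable_funD; exact: mZ.
rewrite ge0_integralD//; last 4 first.
- by move=> x _; exact: Z0.
- exact: mZ.
- by move=> x _; exact: Z0.
- exact: mZ.
rewrite !Z// (_ : \int[mu]_x B%:E = B%:E)%E; last first.
  by rewrite integral_cst//= [mu _]muT mule1.
apply: (@le_trans _ _ (A * b ^+ 2 + (B + (D * b ^+ 2 + E * kappa ^+ 2)))%:E).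
  by rewrite !EFinD !EFinM !leeD// lee_wpmul2l// lee_fin.
rewrite lee_fin (_ : _ + _ = l1 * ((delta + kappa) * b) + l2 * b ^+ 2); last first.
  by rewrite /A /B /D /E; field; rewrite !gt_eqF.
have -> : l1 = l2 * lam.
  rewrite /l1 /l2 -[X in _ = _ * X](@powRr1 _ lam) ?(ltW lam0)// -powRDpos//.
  by congr (_ `^ _); ring.
apply: (@le_trans _ _ (l2 * lam * (eps * b) + l2 * b ^+ 2)).
  apply: lerD => //; apply: ler_wpM2l; first by rewrite mulr_ge0// ltW.
  by apply: ler_wpM2r => //; rewrite ltW.
have -> : l2 * lam * (eps * b) + l2 * b ^+ 2 = 2 * (l2 * b ^+ 2).
  by rewrite /lam; field; rewrite gt_eqF.
rewrite -mulrA ler_pM2l// le_eqVlt; apply/orP; left; apply/eqP.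
rewrite /l2 /lam powRM ?invr_ge0 ?(ltW b0) ?(ltW e0)//.
rewrite -powR_inv1 ?(ltW e0)// -powRrM mulN1r opprB mulrAC.
by rewrite -powR_mulrn ?(ltW b0)// -powRDpos// subrK.
Qed.

End Interpolation.

(** * The L_p norm of a product containing a spike *)

Section SpikeNorm.
Variable R : realType.
Local Notation C := R[i].
Local Notation mu := (@circle_measure R).
Implicit Types P S G : {poly C}.

(** K is the average of the first M = j^2 powers of om * w. It is close to 1
    where om * w is close to 1, at the rate 1 - K = O(M |1 - om w|), although its
    L_2 norm is only M^(-1/2) = 1 / j. *)
Lemma averaging_poly (j : nat) (om : C) : (0 < j)%N -> normc om = 1 ->
  exists2 K : {poly C}, energy K = (j%:R^-1) ^+ 2 &
    forall w, normc w = 1 ->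
      1 <= (j ^ 2)%:R * normc (1 - om * w) + normc K.[w].
Proof.
move=> j0 om1; pose M := (j ^ 2)%N; have M0 : (0 < M)%N by rewrite expn_gt0 j0.
have M0' : (M%:R : R) != 0 by rewrite pnatr_eq0 -lt0n.
have MC0 : (M%:R : C) != 0 by rewrite pnatr_eq0 -lt0n.
have nM : normc (M%:R^-1 : C) = M%:R^-1.
  by rewrite normcV -[M%:R in LHS](rmorph_nat (@real_complex R)) normcR normr_nat.
exists (\sum_(l < M) (M%:R^-1 * om ^+ l) *: 'X^(0 + l)).
  rewrite (energy_sum M 0 (fun l => M%:R^-1 * om ^+ l)).
  under eq_bigr do rewrite normcM normcX om1 expr1n mulr1 nM.
  rewrite sumr_const card_ord -mulr_natr /M natrX.
  by field; rewrite pnatr_eq0 -lt0n.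
move=> w w1; set y := om * w.
have y1 : normc y = 1 by rewrite normcM om1 w1 mulr1.
set K := horner _ _.
have KE : K = M%:R^-1 * \sum_(l < M) y ^+ l.
  rewrite /K horner_sum mulr_sumr; apply: eq_bigr => l _.
  by rewrite hornerZ hornerXn /y exprMn mulrA.
apply: (@le_trans _ _ (normc (1 - K) + normc K)).
  by rewrite -[X in X <= _](@normc1 R) -[X in normc X](subrK K) normcD.
rewrite lerD2r KE.
have -> : 1 - M%:R^-1 * (\sum_(l < M) y ^+ l) =
    M%:R^-1 * \sum_(l < M) (1 - y ^+ l).
  by rewrite sumrB sumr_const card_ord mulrBr mulVf.
have hl (l : 'I_M) : normc (1 - y ^+ l) <= M%:R * normc (1 - y).
  rewrite -opprB subrX1 -mulNr opprB normcM mulrC ler_wpM2r ?normc_ge0//.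
  apply: (le_trans (normc_sum _ _ _)).
  under eq_bigr do rewrite normcX y1 expr1n.
  by rewrite sumr_const card_ord ler_nat ltnW.
rewrite normcM nM ler_pdivrMl ?ltr0n//.
apply: (le_trans (normc_sum _ _ _)).
apply: (le_trans (ler_sum _ (fun i _ => hl i))).
by rewrite sumr_const card_ord -/M -[X in X <= _]mulr_natl.
Qed.

(** With s = j^(-4) and M = j^2, the spike is at most 2 / j^2 after
    multiplication by M |1 - om w|, and the averaging polynomial has L_2 norm
    1 / j; both are at most a constant over j. All the polynomials involved are
    evaluated at powers of z, so their L_2 norms are read off from their
    coefficients. *)
Lemma spiky_product_Lp (p b : R) (j q Q : nat) (a : int) S G :
  1 <= p -> p < 2 -> 0 < b -> (0 < j)%N -> (0 < q)%N -> (0 < Q)%N ->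
  spiky (j%:R^-1 ^+ 4) S -> (size S <= q)%N -> energy S <= 1 ->
  energy G <= b ^+ 2 ->
  (cLnorm mu p (trig_poly a ((S * (G \Po 'X^q)) \Po 'X^Q))
    <= (2 * b * (3 / j%:R) `^ (2 * (p^-1 - 2^-1)))%:E)%E.
Proof.
move=> p1 p2 b0 j0 q0 Q0 [om om1 Sspiky] Sq S1 Gb.
have p0 : 0 < p by rewrite (lt_le_trans _ p1).
have jR : 0 < j%:R :> R by rewrite ltr0n.
have [K K2 Kge] := averaging_poly j0 om1.
set P := _ \Po 'X^Q.
have zQ (x : R) : normc (trig 1 x ^+ Q : C) = 1.
  by rewrite normcX normc_trig expr1n.
have PE (x : R) : P.[trig 1 x] =
    S.[trig 1 x ^+ Q] * ((G \Po 'X^q) \Po 'X^Q).[trig 1 x].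
  by rewrite /P !horner_comp hornerM !hornerXn horner_comp hornerXn.
have main : (\int[mu]_x (normc P.[trig 1 x] `^ p)%:E
    <= (2 * b `^ p * (3 / j%:R) `^ (2 - p))%:E)%E.
  (* 2 / j^2 is the share of f (1 - K), where the peak of f is cancelled; 1 / j is
     that of f K *)
  apply: (@spiky_pth_power _ _ _ _ _ _ (2 / j%:R ^+ 2) (j%:R^-1) _ _
     (fun x => normc ((G \Po 'X^q) \Po 'X^Q).[trig 1 x])
     (fun x => normc (K \Po 'X^Q).[trig 1 x])) => //.
  - exact: circle_measureT.
  - by rewrite invr_gt0.
  - by rewrite divr_gt0.
  - have j1 : 1 <= j%:R :> R by rewrite ler1n.
    suff : 2 / j%:R ^+ 2 <= 2 / j%:R :> R by lra.
    rewrite ler_wpM2l// lef_pV2 ?posrE ?exprn_gt0//.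
    by rewrite expr2 ler_peMr// ltW.
  - exact: measurable_normc_horner.
  - exact: measurable_normc_horner.
  - exact: measurable_normc_horner.
  - by move=> x; exact: normc_ge0.
  - move=> x; rewrite PE normcM [(K \Po _).[_]]horner_comp hornerXn.
    set w := trig 1 x ^+ Q; set Gw := normc (horner (G \Po _ \Po _) _).
    have Gw0 : 0 <= Gw by exact: normc_ge0.
    have := Kge w (zQ x); have := Sspiky w (zQ x).
    set u := normc S.[w]; set v := normc (1 - _); set Kw := normc K.[w].
    have u0 : 0 <= u by exact: normc_ge0.
    move=> uv Kv.
    rewrite -[X in X <= _]mulr1; apply: (le_trans (ler_wpM2l (mulr_ge0 u0 Gw0) Kv)).
    rewrite mulrDr lerD2r.
    have -> : u * Gw * ((j ^ 2)%:R * v) = (u * v) * ((j ^ 2)%:R * Gw) by ring.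
    apply: (le_trans (ler_wpM2r (mulr_ge0 (ler0n _ _) Gw0) uv)).
    rewrite natrX le_eqVlt; apply/orP; left; apply/eqP.
    by field; rewrite gt_eqF.
  - rewrite parseval lee_fin energy_comp// energy_mul_comp//.
    by rewrite -[X in _ <= X]mul1r ler_pM ?energy_ge0.
  - by rewrite parseval lee_fin !energy_comp.
  - by rewrite parseval lee_fin energy_comp// K2.
rewrite cLnormE; under eq_integral do rewrite normc_trig_poly.
apply: (@le_trans _ _ ((2 * b `^ p * (3 / j%:R) `^ (2 - p))%:E `^ p^-1)%E).
  apply: gt0_ler_poweR => //; rewrite ?invr_ge0 ?(ltW p0)// in_itv/= ?leey ?andbT.
    by apply: integral_ge0 => x _; rewrite lee_fin powR_ge0.
  by rewrite lee_fin !mulr_ge0 ?powR_ge0.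
rewrite poweR_EFin lee_fin !powRM ?mulr_ge0 ?powR_ge0//.
rewrite -!powRrM divff ?gt_eqF// powRr1 ?(ltW b0)//.
have -> : (2 - p) / p = 2 * (p^-1 - 2^-1) by field; rewrite gt_eqF.
rewrite ler_wpM2r ?powR_ge0// ler_wpM2r ?(ltW b0)//.
rewrite -[X in _ <= X](@powRr1 _ 2)// ler_powR ?invf_le1//; lra.
Qed.

End SpikeNorm.

(** * Linear spans *)

Section Subspaces.
Variables (K : nzRingType) (V : lmodType K).

Definition subspace (L : set V) :=
  L 0 /\ forall (a : K) u v, L u -> L v -> L (a *: u + v).

Lemma subspaceD (L : set V) u v : subspace L -> L u -> L v -> L (u + v).
Proof. by move=> [_ h] Lu Lv; rewrite -[u]scale1r; exact: h. Qed.

Lemma subspaceZ (L : set V) a u : subspace L -> L u -> L (a *: u).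
Proof. by move=> [L0 h] Lu; rewrite -[_ *: _]addr0; exact: h. Qed.

Lemma subspace_sum (L : set V) (I : Type) (s : seq I) (F : I -> V) :
  subspace L -> (forall i, L (F i)) -> L (\sum_(i <- s) F i).
Proof.
move=> Lsub h; elim/big_ind: _ => //; first by case: Lsub.
by move=> x y; exact: subspaceD.
Qed.

(** Membership in the span, stated through all subspaces: linear maps and
    changes of generators then transport it without coordinates. *)
Definition spanned (s : seq V) (v : V) :=
  forall L : set V, subspace L -> (forall u, u \in s -> L u) -> L v.

End Subspaces.

(** * Products over the digits of the frequency *)

Section DigitProducts.
Variable R : realType.
Local Notation C := R[i].
Variable (phi : nat -> {poly C}).

(** The product over the m lowest base-q digits k_i of k of phi_(k_i)(X^(q^i)).
    For phi_i = X^i and k < q^m it is X^k. *)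
Fixpoint digit_product (q m k : nat) : {poly C} :=
  if m is m'.+1 then
    phi (k %% q) * (digit_product q m' (k %/ q) \Po 'X^q)
  else 1.

(** Only digits below r occur, while the substitutions remain those of base q;
    a list avoids naming these r^m products by numbers in a second base. *)
Fixpoint digit_generators (q r m : nat) : seq {poly C} :=
  if m is m'.+1 then
    [seq phi i * (g \Po 'X^q) | i <- iota 0 r, g <- digit_generators q r m']
  else [:: 1].

Lemma size_digit_generators q r m : size (digit_generators q r m) = (r ^ m)%N.
Proof. by elim: m => [|m IH] //=; rewrite size_allpairs size_iota IH expnS. Qed.

(** Multilinearity: the lowest factor is a combination of the phi_l with l < r,
    and by induction so is each of the remaining ones. *)
Lemma digit_product_spanned q r m k : (0 < q)%N ->
  (forall i, (i < q)%N -> exists c : 'I_r -> C, phi i = \sum_l c l *: phi l) ->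
  spanned (digit_generators q r m) (digit_product q m k).
Proof.
move=> q0 phi_dep; elim: m k => [|m IH] k L Lsub Lgen /=.
  by apply: Lgen; rewrite inE.
have [c ->] := phi_dep _ (ltn_pmod k q0).
rewrite mulr_suml; apply: subspace_sum => // i.
rewrite -scalerAl; apply: subspaceZ => //.
apply: (IH (k %/ q)%N (fun g => L (phi i * (g \Po 'X^q)))).
- split=> [|a u v Lu Lv]; first by move: Lsub.1; rewrite comp_poly0 mulr0.
  rewrite comp_polyD comp_polyZ mulrDr -scalerAr. exact: Lsub.2.
- move=> u um; apply: Lgen; apply: allpairs_f => //.
  by rewrite mem_iota add0n ltn_ord.
Qed.

Lemma energy_digit_product q m k (E : R) : (0 < q)%N -> 0 <= E ->
  (forall i, (i < q)%N -> energy (phi i) <= E) ->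
  (forall i, (i < q)%N -> (size (phi i) <= q)%N) ->
  energy (digit_product q m k) <= E ^+ m.
Proof.
move=> q0 E0 hE hq; elim: m k => [|m IH] k /=; first by rewrite energy1 expr0.
have kq := ltn_pmod k q0.
by rewrite energy_mul_comp ?hq// exprS ler_pM ?energy_ge0 ?hE.
Qed.

End DigitProducts.

(** * Polynomials as elements of L_p *)

Section LpPolynomials.
Variables (R : realType) (p : R) (p1 : 1 <= p).
Local Notation C := R[i].
Local Notation mu := (@circle_measure R).
Implicit Types P : {poly C}.

Definition Lp_poly (a : int) P : Lp_cplx mu p1 :=
  Lp_class (MkLfun (trig_poly_Lfun a P p1)).

Lemma eq_Lp_class (f g : Lfun_cplx mu p1) :
  Lfun_val f = Lfun_val g -> Lp_class f = Lp_class g.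
Proof. by move=> fg; congr Lp_class; apply: val_inj. Qed.

Lemma Lp_polyE a b P Q : trig_poly a P = trig_poly b Q ->
  Lp_poly a P = Lp_poly b Q.
Proof. by move=> h; apply: eq_Lp_class. Qed.

Lemma Lp_polyZD a c P Q :
  Lp_poly a (c *: P + Q) = c *: Lp_poly a P + Lp_poly a Q.
Proof.
rewrite [c *: Lp_poly _ _]Lp_classZ -Lp_classD; apply: eq_Lp_class.
apply/funext => x.
rewrite -[LHS]/(trig_poly a (c *: P + Q) x).
rewrite -[RHS]/(c * trig_poly a P x + trig_poly a Q x).
by rewrite /trig_poly hornerD hornerZ mulrDr mulrCA.
Qed.

Lemma Lp_poly0 a : Lp_poly a 0 = 0.
Proof.
have := Lp_polyZD a (-1) 0 0.
by rewrite scaler0 addr0 scaleN1r addNr.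
Qed.

Lemma Lp_polyD a P Q : Lp_poly a (P + Q) = Lp_poly a P + Lp_poly a Q.
Proof. by rewrite -[P in LHS]scale1r Lp_polyZD scale1r. Qed.

Lemma Lp_polyMXn a n P : Lp_poly a ('X^n * P) = Lp_poly (a + n%:Z) P.
Proof.
apply: Lp_polyE; apply/funext => x.
by rewrite /trig_poly hornerM hornerXn trigD trigX mulrA.
Qed.

Lemma Lp_polyXn a n : Lp_poly a 'X^n = trig_Lp p1 (a + n%:Z).
Proof.
apply: eq_Lp_class; apply/funext => x /=.
by rewrite /trig_poly hornerXn trigD trigX.
Qed.

Definition pnorm (f : Lp_cplx mu p1) : R := complex.Re `|f|.

Lemma pnormE (f : Lp_cplx mu p1) : `|f| = (pnorm f)%:C%C.
Proof.
by rewrite -[f](@Lp_reprK _ _ _ _ _ p1) /pnorm Lp_normE.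
Qed.

Lemma pnormD f g : pnorm (f + g) <= pnorm f + pnorm g.
Proof. by have := ler_normD f g; rewrite !pnormE -rmorphD/= lecR. Qed.

Lemma pnorm_poly_le a P (e : R) :
  (cLnorm mu p (trig_poly a P) <= e%:E)%E -> pnorm (Lp_poly a P) <= e.
Proof.
rewrite /pnorm Lp_normE /= => h; rewrite -lee_fin fineK//.
exact: (@cLnorm_fin_num _ _ _ mu p p1 (MkLfun (trig_poly_Lfun a P p1))).
Qed.

(** Telescoping. With k = k_0 + q k', the difference phi_(k_0) G(X^q) - X^k,
    where G is the digit product of k', is the sum of S_(k_0) G(X^q), bounded by
    [spiky_product_Lp], and of X^(k_0) times the same difference for k' at X^q.
    The power Q and the shift a absorb the changes of variable and the
    unimodular factors met in the induction. *)
Lemma digit_product_error (q m0 : nat) (phi S : nat -> {poly C}) (E : R)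
   (j : nat) (m k Q : nat) (a : int) :
  p < 2 -> (0 < q)%N -> (0 < j)%N -> (0 < Q)%N -> 1 <= E ->
  (forall i, phi i = 'X^i + S i) ->
  (forall i, (i < q)%N -> [/\ spiky (j%:R^-1 ^+ 4) (S i), (size (S i) <= q)%N,
     energy (S i) <= 1, (size (phi i) <= q)%N & energy (phi i) <= E ^+ 2]) ->
  (m <= m0)%N -> (k < q ^ m)%N ->
  pnorm (Lp_poly a ((digit_product phi q m k - 'X^k) \Po 'X^Q))
    <= m%:R * (2 * E ^+ m0 * (3 / j%:R) `^ (2 * (p^-1 - 2^-1))).
Proof.
move=> p2 q0 j0 Q0 E1 phiE Sh.
have E0 : 0 < E by rewrite (lt_le_trans _ E1).
elim: m k Q Q0 a => [|m IH] k Q Q0 a mm0 km.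
  have -> : k = 0%N by case: k km.
  rewrite /= subrr comp_poly0 Lp_poly0 mul0r /pnorm normr0 //.
have kq := ltn_pmod k q0.
have [Sspiky Sq S1 phiq phi4] := Sh _ kq.
set G := digit_product phi q m (k %/ q).
have -> : (digit_product phi q m.+1 k - 'X^k) \Po 'X^Q =
   ((S (k %% q)%N * (G \Po 'X^q)) \Po 'X^Q) +
   'X^(Q * (k %% q))%N * ((G - 'X^(k %/ q)%N) \Po 'X^(q * Q)%N).
  have -> : digit_product phi q m.+1 k - 'X^k = S (k %% q)%N * (G \Po 'X^q) +
      'X^(k %% q)%N * ((G - 'X^(k %/ q)%N) \Po 'X^q).
    rewrite /= -/G phiE comp_polyB comp_Xn_poly mulrDl mulrBr -exprM -exprD.
    have -> : (k %% q + q * (k %/ q))%N = k by rewrite addnC mulnC -divn_eq.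
    by rewrite [X in X - _]addrC -addrA.
  rewrite [LHS]comp_polyD; congr (_ + _); rewrite comp_polyM comp_Xn_poly -exprM.
  by rewrite -comp_polyA comp_Xn_poly -exprM [(q * Q)%N]mulnC.
rewrite Lp_polyD Lp_polyMXn.
apply: (le_trans (pnormD _ _)); rewrite -natr1 mulrDl mul1r addrC lerD//.
  by apply: IH; rewrite ?muln_gt0 ?q0 ?(ltnW mm0)// ltn_divLR// -expnSr.
apply: pnorm_poly_le; apply: spiky_product_Lp => //; first by rewrite exprn_gt0.
apply: (@le_trans _ _ ((E ^+ 2) ^+ m)).
  by apply: energy_digit_product => //;
    [rewrite sqr_ge0|move=> i /Sh[]|move=> i /Sh[]].
by rewrite -!exprM mulnC ler_weXn2l// leq_mul2r ltnW.
Qed.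

Lemma digit_product_Lp_spanned (phi : nat -> {poly C}) q r m k a : (0 < q)%N ->
  (forall i, (i < q)%N -> exists c : 'I_r -> C, phi i = \sum_l c l *: phi l) ->
  spanned [seq Lp_poly a g | g <- digit_generators phi q r m]
    (Lp_poly a (digit_product phi q m k)).
Proof.
move=> q0 dep L Lsub Lgen.
have := @digit_product_spanned R phi q r m k q0 dep (fun P => L (Lp_poly a P)).
apply.
- split=> [|c u v Lu Lv]; first by rewrite Lp_poly0; exact: Lsub.1.
  by rewrite Lp_polyZD; exact: Lsub.2.
- by move=> u um; apply: Lgen; apply: map_f.
Qed.

End LpPolynomials.

(** * Bounding Kolmogorov widths by spanning families *)

Section Widths.
Variables (R : realType) (V : normedModType R[i]).

Definition lincombs n (v : 'I_n -> V) : set V :=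
  [set \sum_i c i *: v i | c in [set: 'I_n -> R[i]]].

Lemma lincombs_subspace n (v : 'I_n -> V) : linear_subspace (lincombs v).
Proof.
split=> [|a _ _ [c _ <-] [c' _ <-]].
  by exists (fun=> 0) => //; rewrite big1// => i _; rewrite scale0r.
exists (fun i => a * c i + c' i) => //; rewrite scaler_sumr -big_split.
by apply: eq_bigr => i _; rewrite scalerDl scalerA.
Qed.

(** The linear combinations of n vectors need not have n independent
    generators; as long as a relation remains, some vector can be dropped. *)
Lemma lincombs_dim_le n (v : 'I_n -> V) : dim_le n (lincombs v).
Proof.
elim: n v => [|n IH] v.
  by exists 0%N, v; split=> // c _ [].
have [free|] := pselect (forall c : 'I_n.+1 -> R[i],
    \sum_i c i *: v i = 0 -> forall i, c i = 0).
  by exists n.+1, v; split.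
move=> /existsNP[c] /not_implyP[cv0] /existsNP[j] /eqP cj.
have vj : v j = \sum_i (- (c (lift j i) / c j)) *: v (lift j i).
  move: cv0; rewrite (bigD1_ord j)//= => /eqP; rewrite addr_eq0 => /eqP cv.
  rewrite -[LHS](scalerK cj) cv scalerN scaler_sumr -sumrN.
  by apply: eq_bigr => i _; rewrite scalerA scaleNr mulrC.
have -> : lincombs v = lincombs (fun i => v (lift j i)).
  apply/seteqP; split=> _ [b _ <-].
    (* substitute the relation for v j *)
    exists (fun i => b (lift j i) - b j * (c (lift j i) / c j)) => //.
    rewrite [RHS](bigD1_ord j)//= vj scaler_sumr -big_split.
    by apply: eq_bigr => i _; rewrite scalerA scalerBl mulrN scaleNr addrC.
  exists (fun i => if unlift j i is Some l then b l else 0) => //.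
  rewrite (bigD1_ord j)//= unlift_none scale0r add0r.
  by apply: eq_bigr => i _; rewrite liftK.
have [m [b [mn bfree bE]]] := IH (fun i => v (lift j i)).
by exists m, b; split => //; exact: leqW.
Qed.

Lemma kolmogorov_width_le (W : set V) (s : seq V) (e : R) :
  (forall x, W x -> exists2 y, spanned s y & complex.Re `|x - y| <= e) ->
  (kolmogorov_width (size s) W <= e%:E)%E.
Proof.
move=> h; pose v (i : 'I_(size s)) := s`_i.
apply: (@le_trans _ _ (ereal_sup [set
      ereal_inf [set (complex.Re `|x - y|)%:E | y in lincombs v] | x in W])).
  apply: ereal_inf_lbound; exists (lincombs v) => //.
  by split; [exact: lincombs_subspace|exact: lincombs_dim_le].
apply: ge_ereal_sup => _ [x Wx <-]; have [y ys xy] := h _ Wx.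
apply: (@le_trans _ _ (complex.Re `|x - y|)%:E); last by rewrite lee_fin.
apply: ereal_inf_lbound; exists y => //; apply: ys.
  by split; [exact: (lincombs_subspace v).1|exact: (lincombs_subspace v).2].
move=> u /(nthP 0)[i si <-].
exists (fun l => (l == Ordinal si)%:R) => //.
rewrite (bigD1 (Ordinal si))//= eqxx scale1r big1 ?addr0// => l /negbTE ->.
by rewrite scale0r.
Qed.

Lemma kolmogorov_width_ge0 n (W : set V) : W !=set0 ->
  (0 <= kolmogorov_width n W)%E.
Proof.
move=> [x Wx]; apply: le_ereal_inf_tmp => _ [L _ <-].
apply: (@le_trans _ _ (ereal_inf [set (complex.Re `|x - y|)%:E | y in L])).
  apply: le_ereal_inf_tmp => _ [y _ <-]; rewrite lee_fin.
  by have := normr_ge0 (x - y); rewrite lecE => /andP[].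
by apply: ereal_sup_ubound; exists x.
Qed.

End Widths.

(** * Number and size of the digits *)

Section DigitChoice.
Variable R : realType.

Lemma expR1_ge2 : 2 <= expR 1 :> R.
Proof. by have := expR_ge1Dx (1 : R); lra. Qed.

Lemma expR_half_le2 : expR 2^-1 <= 2 :> R.
Proof.
have := expR_ge1Dx (- 2^-1 : R); rewrite expRN => h.
rewrite -[X in X <= _]invrK -[X in _ <= X]invrK lef_pV2 ?posrE ?invr_gt0 ?expR_gt0//.
by apply: le_trans h; lra.
Qed.

(** Taking m about 3 theta makes 2^(-m) at most exp (- theta - 1). Taking
    logarithms in 2 N < (2 j^8)^m gives log j >= 10 theta / alpha, so that
    (3 / j)^(2 alpha) is at most exp (2 - 20 theta), against which the factors m
    and 2^m, both at most exp (4 theta), are harmless. Minimality of j bounds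
    (j^8)^m by 2 N 2^(-m) (1 + 1 / (j - 1))^(8 m), and the last factor is at most
    e because j - 1 >= 8 m. *)
Lemma parameter_choice (alpha theta : R) (N : nat) :
  0 < alpha -> alpha <= 2^-1 -> 50 <= theta -> (0 < N)%N ->
  ln N%:R = 324 * theta ^+ 2 / alpha ->
  exists m j : nat, [/\ (0 < j)%N, (2 * N < (j ^ 8 + j ^ 8) ^ m)%N,
    ((j ^ 8) ^ m)%:R <= 2 * N%:R * expR (- theta) &
    m%:R * (2 * 2 ^+ m * (3 / j%:R) `^ (2 * alpha)) <= 8 / alpha * expR (- theta)].
Proof.
move=> a0 a2 th50 N0 lnN.
have [m [m_ge m_le]] : exists m : nat, 3 * theta <= m%:R /\ m%:R <= 4 * theta.
  exists (Num.truncn (3 * theta)).+1.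
  have th0 : 0 <= 3 * theta by lra.
  have /andP[h1 h2] := truncn_itv th0; split; first exact: ltW.
  by rewrite -natr1; lra.
have m0 : (0 < m)%N by rewrite -(ltr0n R); lra.
pose big j := (2 * N < (j ^ 8 + j ^ 8) ^ m)%N.
have exb : exists j, big j.
  exists (2 * N).+1; rewrite /big.
  have h : ((2 * N).+1 <= (2 * N).+1 ^ 8 + (2 * N).+1 ^ 8)%N.
    by rewrite (leq_trans _ (leq_addr _ _))// -[X in (X <= _)%N]expn1 leq_pexp2l.
  apply: (leq_trans h).
  by rewrite -[X in (X <= _)%N]expn1 leq_pexp2l// (leq_trans _ h).
pose j := ex_minn exb.
have [bj minj] : big j /\ forall i, big i -> (j <= i)%N.
  by rewrite /j; case: ex_minnP.
have j0 : (0 < j)%N.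
  by rewrite lt0n; apply: contraTneq bj => ->; rewrite /big !exp0n.
have jR : 0 < j%:R :> R by rewrite ltr0n.
pose x : R := ln j%:R.
have jE : j%:R = expR x by rewrite /x lnK ?posrE.
have x0 : 0 <= x by rewrite ln_ge0// ler1n.
have NR : 0 < N%:R :> R by rewrite ltr0n.
have exp4 : expR (m%:R) <= expR (4 * theta) by rewrite ler_expR.
have m2 : 2 ^+ m <= expR m%:R :> R.
  by rewrite -[m%:R]mulr1 expRM_natl lerXn2r ?nnegrE ?expR_ge0 ?expR1_ge2.
have xlow : 10 * theta / alpha <= x.
  have : N%:R <= expR (m%:R * (1 + 8 * x)).
    have -> : expR (m%:R * (1 + 8 * x)) = (expR 1 * j%:R ^+ 8) ^+ m.
      by rewrite expRM_natl expRD jE -expRM_natl.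
    apply: (@le_trans _ _ ((j ^ 8 + j ^ 8) ^ m)%:R).
      by rewrite ler_nat (leq_trans _ (ltnW bj))// leq_pmull.
    have j8 : 0 <= j%:R ^+ 8 :> R by rewrite exprn_ge0// ltW.
    rewrite natrX natrD natrX lerXn2r ?nnegrE ?addr_ge0 ?mulr_ge0 ?expR_ge0//.
    by have := expR1_ge2; nra.
  rewrite -[X in X <= _]lnK ?posrE// ler_expR lnN => h.
  have h' : 324 * theta ^+ 2 / alpha <= 4 * theta * (1 + 8 * x).
    by apply: (le_trans h); rewrite ler_wpM2r//; lra.
  have al1 : 1 <= alpha^-1 by rewrite invf_ge1//; lra.
  set ia := alpha^-1 in h' al1 *.
  have th0 : 0 < 4 * theta by lra.
  have : 81 * theta * ia <= 1 + 8 * x.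
    rewrite -(ler_pM2l th0); apply: le_trans h'.
    by rewrite le_eqVlt; apply/orP; left; apply/eqP; ring.
  have : 50 <= theta * ia by nra.
  by rewrite -!mulrA; lra.
have al2 : 2 <= alpha^-1 by rewrite -[X in X <= _]invrK lef_pV2// posrE; lra.
have x20 : 20 * theta <= x.
  apply: le_trans xlow; set ia := alpha^-1 in al2 *; nra.
exists m, j; split=> //.
- have j8m : 8 * m%:R <= j%:R - 1 :> R.
    have h1 : 1 + 10 * theta <= expR (10 * theta) by exact: expR_ge1Dx.
    have h2 : expR (10 * theta) ^+ 2 <= j%:R.
      by rewrite -expRM_natl jE ler_expR; lra.
    by nra.
  have jj : j.-1%:R = j%:R - 1 :> R by rewrite -subn1 natrB.
  set y : R := j.-1%:R; have y0 : 0 < y.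
    have : 1 <= m%:R :> R by rewrite ler1n.
    by rewrite /y jj; lra.
  have small : 2 ^+ m * y ^+ (8 * m) <= 2 * N%:R.
    have : ~~ big j.-1.
      by apply/negP => /minj; rewrite -ltnS prednK// ltnn.
    rewrite /big -leqNgt -(ler_nat R) natrM; congr (_ <= _).
    by rewrite natrX natrD natrX exprM -exprMn; congr (_ ^+ m); rewrite /y; ring.
  have grow : j%:R ^+ (8 * m) <= y ^+ (8 * m) * expR 1 :> R.
    have -> : j%:R = y * (1 + y^-1).
      by rewrite mulrDr mulr1 divff ?gt_eqF// /y jj subrK.
    rewrite exprMn ler_wpM2l ?exprn_ge0 ?(ltW y0)//.
    apply: (@le_trans _ _ (expR y^-1 ^+ (8 * m))).
      by rewrite lerXn2r ?nnegrE ?expR_ge0 ?addr_ge0 ?invr_ge0 ?(ltW y0)//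
        expR_ge1Dx.
    rewrite -expRM_natl ler_expR ler_pdivrMr// mul1r natrM /y jj //.
  have m2low : expR (theta + 1) <= 2 ^+ m :> R.
    apply: (@le_trans _ _ (expR 2^-1 ^+ m)); last first.
      by rewrite lerXn2r ?nnegrE ?expR_ge0 ?expR_half_le2.
    by rewrite -expRM_natl ler_expR; lra.
  rewrite -expnM natrX; apply: (le_trans grow).
  rewrite expRN ler_pdivlMr ?expR_gt0// -mulrA -expRD [1 + _]addrC.
  apply: le_trans small; rewrite mulrC ler_wpM2r ?exprn_ge0 ?(ltW y0)//.
- have pw : (3 / j%:R) `^ (2 * alpha) <= expR (2 - 20 * theta).
    rewrite /powR gt_eqF ?divr_gt0// ler_expR ln_div ?posrE// -/x.
    have l3 : ln 3 <= 2 :> R.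
      by rewrite -[X in _ <= X]expRK ler_ln ?posrE ?expR_gt0//;
        have := expR_ge1Dx (2 : R); lra.
    have : alpha * x >= 10 * theta by rewrite [alpha * x]mulrC -ler_pdivrMr.
    have := mulr_ge0 (ltW a0) x0; nra.
  have m1 : m%:R <= expR (4 * theta).
    apply: le_trans exp4; apply: le_trans m2; rewrite -natrX ler_nat.
    by rewrite ltnW// ltn_expl.
  have m3 : 2 * 2 ^+ m <= 2 * expR (4 * theta) by rewrite ler_wpM2l// (le_trans m2).
  apply: (@le_trans _ _ (expR (4 * theta) *
      (2 * expR (4 * theta) * expR (2 - 20 * theta)))).
    rewrite ler_pM ?mulr_ge0 ?powR_ge0 ?exprn_ge0//.
    by rewrite ler_pM ?mulr_ge0 ?powR_ge0 ?exprn_ge0.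
  rewrite -mulrA mulrCA -!expRD.
  apply: ler_pM => //; rewrite ?expR_ge0 ?ler_expR//; lra.
Qed.

End DigitChoice.

(** * Widths of the trigonometric system *)

Section TrigWidth.
Variables (R : realType) (p : R) (p1 : 1 <= p) (p2 : p < 2).
Local Notation C := R[i].

(** The gadget is used with r = j^8, so that s = r^(-1/2) = j^(-4). *)
Lemma trig_width_le (N m j : nat) : (0 < j)%N ->
  (2 * N < (j ^ 8 + j ^ 8) ^ m)%N ->
  (kolmogorov_width ((j ^ 8) ^ m) (trig_system p1 N)
    <= (m%:R * (2 * 2 ^+ m * (3 / j%:R) `^ (2 * (p^-1 - 2^-1))))%:E)%E.
Proof.
move=> j0 Nm; set r := (j ^ 8)%N; set q := (r + r)%N.
have r0 : (0 < r)%N by rewrite expn_gt0 j0.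
have q0 : (0 < q)%N by rewrite addn_gt0 r0.
pose zeta : C := trig 1 (r%:R^-1 : R).
have zprim : r.-primitive_root zeta by exact: trig_inv_prim_root.
have zeta1 : normc zeta = 1 by exact: normc_trig.
pose s : R := j%:R^-1 ^+ 4.
have s0 : 0 <= s by rewrite exprn_ge0 ?invr_ge0.
have sr : s ^+ 2 * r%:R = 1.
  by rewrite /s /r natrX -exprM -exprMn mulVf ?expr1n// pnatr_eq0 -lt0n.
pose phi := spiked r zeta s.
pose gens := [seq Lp_poly p1 (- N%:Z) g | g <- digit_generators phi q r m].
have <- : size gens = (r ^ m)%N by rewrite size_map size_digit_generators.
apply: kolmogorov_width_le => _ [k kN <-].
have [n nE] : exists n : nat, k + N%:Z = n%:Z.
  exists (absz (k + N%:Z)); rewrite gez0_abs//.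
  by move: kN => /=; rewrite ler_norml -lerBlDr sub0r => /andP[].
have n2N : (n < q ^ m)%N.
  apply: leq_ltn_trans Nm; rewrite -lez_nat -nE mul2n -addnn PoszD lerD2r.
  by move: kN => /=; rewrite ler_norml => /andP[].
exists (Lp_poly p1 (- N%:Z) (digit_product phi q m n)).
  by apply: digit_product_Lp_spanned => // i iq; exact: spiked_span.
have -> : trig_Lp p1 k = Lp_poly p1 (- N%:Z) 'X^n.
  by rewrite Lp_polyXn -nE addrC addrK.
(* the trivial power X^1 starts the induction over scales *)
rewrite distrC.
have -> : Lp_poly p1 (- N%:Z) (digit_product phi q m n) - Lp_poly p1 (- N%:Z) 'X^n
   = Lp_poly p1 (- N%:Z) ((digit_product phi q m n - 'X^n) \Po 'X^1).
  by rewrite expr1 comp_polyXr addrC -scaleN1r -Lp_polyZD scaleN1r addrC.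
apply: (@digit_product_error _ _ p1 q m phi (spike r zeta s)) => //.
  by rewrite ler1n.
move=> i iq; split.
- exact: spiky_spike.
- exact: size_spike.
- by rewrite energy_spike.
- exact: size_spiked.
- rewrite (_ : 2 ^+ 2 = 4 :> R); first exact: energy_spiked.
  by rewrite -natrX.
Qed.

End TrigWidth.

(** * Asymptotics *)

Section Growth.
Variables (R : realType) (alpha : R) (a0 : 0 < alpha).
Let theta (N : nat) : R := 18^-1 * Num.sqrt (alpha * ln N%:R).

Lemma near_theta_ge (A : R) : \forall N \near \oo, A <= theta N.
Proof.
have : \forall N \near \oo, expR ((18 * `|A|) ^+ 2 / alpha) <= N%:R :> R.
  exact: nbhs_infty_ger.
apply: filterS => N hN.
have N0 : 0 < N%:R :> R by rewrite (lt_le_trans _ hN) ?expR_gt0.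
rewrite /theta ler_pdivlMl//; apply: (@le_trans _ _ (18 * `|A|)).
  by rewrite ler_pM2l// ler_norm.
rewrite -[X in X <= _]ger0_norm ?mulr_ge0// -sqrtr_sqr ler_wsqrtr//.
have : (18 * `|A|) ^+ 2 / alpha <= ln N%:R by rewrite -ler_expR lnK.
by rewrite ler_pdivrMr// [X in _ <= X]mulrC.
Qed.

Lemma cvg_expR_theta : expR (- theta N) @[N --> \oo] --> 0.
Proof.
apply/cvgrPdist_le => e e0.
have := near_theta_ge (- ln e); apply: filterS => N hN.
rewrite sub0r normrN ger0_norm ?expR_ge0// -[X in _ <= X]lnK ?posrE// ler_expR.
by rewrite lerNl.
Qed.

End Growth.

Theorem theorem1 (R : realType) (p : R) (p1 : 1 <= p) (p2 : p < 2) :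
  let alpha : R := p^-1 - 2^-1 in
  let theta (N : nat) : R := 18^-1 * Num.sqrt (alpha * ln N%:R) in
  let bound (N : nat) : R := 2 * N%:R * expR (- theta N) in
  (exists n : nat -> nat,
    [/\ forall N : nat, (0 < N)%N ->
          324 / alpha * Num.max 50 (ln (4 / alpha)) ^+ 2 <= ln N%:R ->
          (n N)%:R <= bound N /\
          (kolmogorov_width (n N) (trig_system p1 N)
             <= (8 / alpha * expR (- theta N))%:E)%E,
        \forall N \near \oo, (n N)%:R <= bound N,
        (bound : nat -> R^o) =o_\oo (fun N : nat => N%:R : R^o) &
        kolmogorov_width (n N) (trig_system p1 N) @[N --> \oo] --> 0%E])
  /\ not_rigid (trig_system p1).
Proof.
move=> alpha theta bound.
have a0 : 0 < alpha by rewrite subr_gt0 ltf_pV2 ?posrE// (lt_le_trans _ p1).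
have a2 : alpha <= 2^-1.
  have : p^-1 <= 1 by rewrite invf_le1// (lt_le_trans _ p1).
  by rewrite /alpha; lra.
have key N : exists n : nat, (0 < N)%N -> 50 <= theta N ->
    n%:R <= bound N /\ (kolmogorov_width n (trig_system p1 N)
             <= (8 / alpha * expR (- theta N))%:E)%E.
  have [/andP[N0 th50]|h] := boolP ((0 < N)%N && (50 <= theta N)); last first.
    by exists 0%N => N0 th; rewrite N0 th in h.
  have ln0 : 0 <= alpha * ln N%:R.
    by rewrite mulr_ge0 ?(ltW a0)// ln_ge0// ler1n.
  have lnE : ln N%:R = 324 * theta N ^+ 2 / alpha.
    by rewrite /theta exprMn sqr_sqrtr//; field; rewrite gt_eqF.
  have [m [j [j0 Nm dim err]]] := parameter_choice a0 a2 th50 N0 lnE.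
  exists ((j ^ 8) ^ m)%N => _ _; split => //.
  by apply: (le_trans (trig_width_le p1 p2 j0 Nm)); rewrite lee_fin.
have [n nP] := choice key.
have large N : (0 < N)%N ->
    324 / alpha * Num.max 50 (ln (4 / alpha)) ^+ 2 <= ln N%:R -> 50 <= theta N.
  move=> N0 h; have M50 : 50 <= Num.max 50 (ln (4 / alpha)) by rewrite le_max lexx.
  rewrite /theta ler_pdivlMl// -[X in X <= _]ger0_norm ?mulr_ge0// -sqrtr_sqr.
  rewrite ler_wsqrtr// [X in _ <= X]mulrC -ler_pdivrMr//; apply: le_trans h.
  rewrite [X in _ <= X]mulrAC ler_pM2r ?invr_gt0// exprMn.
  by rewrite (_ : 18 ^+ 2 = 324) ?ler_pM2l ?lerXn2r ?nnegrE//; lra.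
have near_nP : \forall N \near \oo, (n N)%:R <= bound N /\
   (kolmogorov_width (n N) (trig_system p1 N)
             <= (8 / alpha * expR (- theta N))%:E)%E.
  apply: filterS2 (near_theta_ge a0 50) (nbhs_infty_gt 0) => N th50 N0.
  exact: nP.
have bound_littleo : (bound : nat -> R^o) =o_\oo (fun N : nat => N%:R : R^o).
  apply/eqoP => e e0; have e2 : 0 < e / 2 by rewrite divr_gt0.
  have /cvgrPdist_le /(_ _ e2) := cvg_expR_theta a0.
  apply: filterS => N; rewrite sub0r normrN ger0_norm ?expR_ge0// => hN.
  rewrite /bound !ger0_norm ?mulr_ge0 ?expR_ge0//.
  by rewrite mulrAC ler_wpM2r//; move: hN; rewrite -/(theta N); lra.
have width_cvg : kolmogorov_width (n N) (trig_system p1 N) @[N --> \oo] --> 0%E.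
  apply: (@squeeze_cvge _ _ _ _ (fun=> 0%E) _
    (fun N => (8 / alpha * expR (- theta N))%:E)).
  - apply: filterS near_nP => N [_ ->]; rewrite andbT.
    apply: kolmogorov_width_ge0; exists (trig_Lp p1 0); by exists 0.
  - exact: cvg_cst.
  - apply: cvg_EFin; first by apply: nearW.
    rewrite -[X in _ --> X](mulr0 (8 / alpha)); apply: cvgM; first exact: cvg_cst.
    exact: (cvg_expR_theta a0).
split.
  exists n; split => //.
  - by move=> N N0 /(large _ N0); exact: nP.
  - by apply: filterS near_nP => N [].
exists n; split => //.
apply/eqoP => e e0; move/eqoP : bound_littleo => /(_ e e0).
apply: filterS2 near_nP => N [nb _].
by rewrite !ger0_norm ?mulr_ge0 ?expR_ge0//; exact: le_trans.
Qed.
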